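(* Let $d\ge3$ and $0<\beta<\infty$, and suppose $m_{{\rm s},\beta}\neq0$. Then the transverse correlation $\rho_0(S_x^{(2)}S_y^{(2)})$ does not decay as $|\rho_0(S_x^{(2)}S_y^{(2)})|=o(|x-y|^{-(d-2)})$, i.e. it is not true that $|x-y|^{d-2}|\rho_0(S_x^{(2)}S_y^{(2)})|\to0$ as $|x-y|\to\infty$.
   Context: Spin-$S$ ($S\in\{1/2,1,\dots\}$) operators $S_x^{(i)}$, $i=1,2,3$, at each $x\in\mathbb{Z}^d$ with the usual commutation relations; quasi-local algebra from $\mathfrak{A}_\Gamma=\bigotimes_{x\in\Gamma}M_{2S+1}(\mathbb{C})$. For a positive integer $L$, $\Lambda_L=\{-L+1,\dots,L\}^d$ with periodic boundary conditions; $H_{0,{\rm p}}^{(\Lambda)}=\sum_{\{x,y\}\subset\Lambda:|x-y|=1}\mathbf{S}_x\cdot\mathbf{S}_y$, $O^{(\Lambda)}=\sum_{x\in\Lambda}(-1)^{x^{(1)}+\cdots+x^{(d)}}S_x^{(3)}$, $H_{\rm p}^{(\Lambda)}(B)=H_{0,{\rm p}}^{(\Lambda)}-BO^{(\Lambda)}$. The Gibbs state is $\langle\cdot\rangle^{(\Lambda)}_{B,\beta}={\rm Tr}[(\cdot)e^{-\beta H_{\rm p}^{(\Lambda)}(B)}]/{\rm Tr}\,e^{-\beta H_{\rm p}^{(\Lambda)}(B)}$; $\rho_B$ is its weak$^\ast$-limit as $L\to\infty$ and $\rho_0={\rm weak}^\ast\text{-}\lim_{B\searrow0}\rho_B$ (along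 suitable subsequences). The spontaneous magnetization is $m_{{\rm s},\beta}=\lim_{B\searrow0}\frac{1}{|\Lambda|}\rho_B(O^{(\Lambda)})$ (independent of $\Lambda$ by period-2 translation invariance). *)

(* Defs.v *)
From HB Require Import structures.
From mathcomp Require Import all_boot all_order all_algebra.
From mathcomp Require Import complex.
From mathcomp Require Import all_classical all_reals all_analysis.
Set Implicit Arguments. Unset Strict Implicit. Unset Printing Implicit Defensive.
Import Order.TTheory GRing.Theory Num.Theory.
Import numFieldNormedType.Exports.
Local Open Scope ring_scope.
Local Open Scope complex_scope.

Section Heisenberg.
Variable R : realType.
Local Notation C := R[i].

Definition cvgC (u : nat -> C) (l : C) : Prop :=
  forall e : R, 0 < e -> exists N : nat, forall n, (N <= n)%N -> `|u n - l| < e%:C.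

Definition climn (u : nat -> C) : C :=
  @Complex R (limn (fun n => complex.Re (u n) : R)) (limn (fun n => complex.Im (u n) : R)).

Definition cvg0plus (f : R -> C) (l : C) : Prop :=
  forall e : R, 0 < e -> exists2 delta : R, 0 < delta &
    forall B : R, 0 < B -> B < delta -> `|f B - l| < e%:C.

Variables (d twoS : nat).
Definition spinS : R := twoS%:R / 2.

(* ---------- single-site spin-S matrices ----------
   basis index m : 'I_(2S+1) <-> S^(3)-eigenvalue M = S - m. *)
Definition mval (m : 'I_twoS.+1) : R := spinS - m%:R.
Definition smat := 'I_twoS.+1 -> 'I_twoS.+1 -> C.

Definition Sz : smat := fun m' m => if m' == m then (mval m)%:C else 0.
Definition Splus : smat := fun m' m =>
  if mval m' == mval m + 1
  then (Num.sqrt (spinS * (spinS + 1) - mval m * (mval m + 1)))%:C else 0.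
Definition Sminus : smat := fun m' m =>
  if mval m' == mval m - 1
  then (Num.sqrt (spinS * (spinS + 1) - mval m * (mval m - 1)))%:C else 0.
Definition Sx : smat := fun m' m => (Splus m' m + Sminus m' m) / 2%:R.
Definition Sy : smat := fun m' m => (Splus m' m - Sminus m' m) / (2%:R * 'i).
Definition Scomp (i : 'I_3) : smat :=
  if val i == 0%N then Sx else if val i == 1%N then Sy else Sz.

(* ---------- boxes ----------
   For L : nat, [site L] is Lambda_{L+1} = {-L, ..., L+1}^d; the ordinal
   coordinate k : 'I_(2L+2) stands for the integer k - L. *)
Definition site (L : nat) := {ffun 'I_d -> 'I_(L.*2.+2)}.
Definition coord (L : nat) (x : site L) (j : 'I_d) : int := (x j)%:Z - L%:Z.

Definition adj (L : nat) (x y : site L) : bool :=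
  [exists j : 'I_d,
     (((x j).+1 %% L.*2.+2 == y j) || ((y j).+1 %% L.*2.+2 == x j))%N
     && [forall k : 'I_d, (k != j) ==> (x k == y k)]].

Definition conf (L : nat) := {ffun site L -> 'I_twoS.+1}.
Definition op (L : nat) := conf L -> conf L -> C.

Definition opmul (L : nat) (A B : op L) : op L :=
  fun s t => \sum_(u : conf L) A s u * B u t.
Definition opadd (L : nat) (A B : op L) : op L := fun s t => A s t + B s t.
Definition opscale (L : nat) (c : C) (A : op L) : op L := fun s t => c * A s t.
Definition opid (L : nat) : op L := fun s t => if s == t then 1 else 0.
Definition oppow (L : nat) (A : op L) (k : nat) : op L := iter k (opmul A) (@opid L).
Definition trace (L : nat) (A : op L) : C := \sum_(s : conf L) A s s.

Definition at_site (L : nat) (x : site L) (a : smat) : op L :=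
  fun s t => if [forall y : site L, (y != x) ==> (s y == t y)]
             then a (s x) (t x) else 0.

Definition expm (L : nat) (A : op L) : op L :=
  fun s t => climn (fun n => \sum_(k < n) (oppow A k s t) / (k`!)%:R).

(* H_{0,p} = sum over nearest-neighbour pairs {x,y} of S_x . S_y ;
   each unordered pair appears twice as an ordered pair, hence 1/2 *)
Definition H0 (L : nat) : op L :=
  fun s t => (2%:R)^-1 * \sum_(x : site L) \sum_(y : site L | adj x y)
     \sum_(i < 3) opmul (at_site x (Scomp i)) (at_site y (Scomp i)) s t.

Definition stag (L : nat) : op L :=
  fun s t => \sum_(x : site L)
     (-1) ^ (\sum_(j < d) coord x j) * at_site x Sz s t.

Definition Ham (L : nat) (B : R) : op L :=
  fun s t => H0 s t - B%:C * stag s t.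

Definition gibbs (L : nat) (beta B : R) (A : op L) : C :=
  trace (opmul A (expm (opscale (- beta)%:C (@Ham L B)))) /
  trace (expm (opscale (- beta)%:C (@Ham L B))).

(* ---------- local observables and their embedding ----------
   A local observable is an element of the algebra of a box Lambda_{L+1};
   every finite subset of Z^d is contained in such a box. *)
Definition emb_site (L L' : nat) (x : site L) : site L' :=
  [ffun j => inord ((x j) + (L' - L))%N].
Definition restrict (L L' : nat) (s : conf L') : conf L :=
  [ffun x => s (@emb_site L L' x)].
Definition embed (L L' : nat) (A : op L) : op L' :=
  fun s t => if (L <= L')%N then
     (if [forall y : site L', (y \notin codom (@emb_site L L')) ==> (s y == t y)]
      then A (@restrict L L' s) (@restrict L L' t) else 0)
     else 0.

Definition inf_vol_limit (beta B : R) (rho : forall L, op L -> C) : Prop :=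
  exists Ls : nat -> nat, (forall k, (Ls k < Ls k.+1)%N) /\
    forall (L : nat) (A : op L),
      cvgC (fun k => gibbs beta B (@embed L (Ls k) A)) (rho L A).

Definition pt := 'I_d -> int.
Definition rad (x : pt) : nat := \max_(j < d) absz (x j).
Definition to_site (L : nat) (x : pt) : site L :=
  [ffun j => inord (absz (x j + L%:Z))].
Definition dist (x y : pt) : R :=
  Num.sqrt (\sum_(j < d) ((x j - y j)%:~R) ^+ 2).

Definition box2 (x y : pt) : nat := maxn (rad x) (rad y).
Definition S2S2 (x y : pt) : op (box2 x y) :=
  opmul (at_site (@to_site (box2 x y) x) Sy) (at_site (@to_site (box2 x y) y) Sy).

End Heisenberg.

(* Main.v *)
Require Import Defs.
From HB Require Import structures.
From mathcomp Require Import all_boot all_order all_algebra.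
From mathcomp Require Import complex.
From mathcomp Require Import all_classical all_reals all_analysis.
From mathcomp Require Import zify ring lra.
Set Implicit Arguments. Unset Strict Implicit. Unset Printing Implicit Defensive.
Import Order.TTheory GRing.Theory Num.Theory.
Import numFieldNormedType.Exports.
Local Open Scope ring_scope.

(** In finite volume, apply the Bogoliubov inequality
      [2 |<[C, A]>| <= <[C, [H, C]]> + 2 beta <A^2>]
    to [C = t sum_x F(x) S_x^(1)], where [F] is a tent equal to [n] on a box of
    side [2n] and vanishing outside the box of side [4n], and to
    [A = sum_x (-1)^x S_x^(2)] over the smaller box.  The commutator is
    [t n (2n)^d] times the staggered magnetization [m].  Since the rotation
    generated by the total [S^(1)] leaves the exchange interaction invariant, the
    double commutator only sees the gradient of [F], up to a term proportional
    to [B]; it is [O(t^2 n^d) + O(B)].  Letting the volume tend to infinity, then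
    [B] to [0], and choosing [t = s n] gives
      [2 s n^2 (2n)^d |m| <= O(s^2 n^(d+2)) + 2 beta sum_(x, y) |rho_0(S_x^(2) S_y^(2))|].
    If the correlation were [o(|x-y|^-(d-2))], the last sum would be
    [o(n^(d+2))], and a small fixed [s] yields a contradiction when [m <> 0]. *)

(** * Bogoliubov inequality *)

(** The inequality is kept in additive form, with no quotient and no Duhamel product: a weighted
    arithmetic-geometric mean, entry by entry in the eigenbasis of [H], suffices, and every term is
    continuous in finitely many local expectations, so it survives both limits. The free parameter t
    replaces the optimisation of a product.

    The tent is forced by the scaling. The correlation sum lives at scale n^(d+2): about n^d points,
    times a sum of |y|^-(d-2) over a ball of radius n. A sharp cutoff has gradient energy n^(d-1)
    and would only yield a lower bound of order n^(d+1). A unit slope on a shell of width n costs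
    n^d but gains the height n on the whole inner box, which reaches n^(d+2).

    The field term has size B t^2 n^(d+2), so B must tend to 0 while n and t are fixed.

    The magnetization is given as an average over some box unrelated to the inner box. A symmetry of
    the periodic Hamiltonian makes the staggered one-point function constant already in finite
    volume, which identifies the averages over the two boxes. *)

Section MatrixState.
Local Open Scope sesquilinear_scope.
Variables (C : numClosedFieldType) (n : nat).
Implicit Types (X Y A B H W : 'M[C]_n).

Definition comm_mxd X Y : 'M[C]_n := X *m Y - Y *m X.

Lemma comm_mxdM X Y A : comm_mxd X (Y *m A) = comm_mxd X Y *m A + Y *m comm_mxd X A.
Proof.
by rewrite /comm_mxd mulmxBl mulmxBr !mulmxA addrA -[X in _ = X - _]addrA addNr addr0.
Qed.

Lemma comm_mxdZ X c Y : comm_mxd X (c *: Y) = c *: comm_mxd X Y.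
Proof. by rewrite /comm_mxd -scalemxAr -scalemxAl scalerBr. Qed.

Lemma comm_mxdB X Y A : comm_mxd X (Y - A) = comm_mxd X Y - comm_mxd X A.
Proof.
rewrite /comm_mxd mulmxBl mulmxBr !opprB [A *m X - _]addrC addrACA.
by rewrite [_ + A *m X]addrC.
Qed.

Lemma comm_mxd_sum X (I : Type) (r : seq I) (P : pred I) (F : I -> 'M[C]_n) :
  comm_mxd X (\sum_(i <- r | P i) F i) = \sum_(i <- r | P i) comm_mxd X (F i).
Proof. by rewrite /comm_mxd mulmx_sumr mulmx_suml -sumrB. Qed.

Lemma comm_mxd_suml X (I : Type) (r : seq I) (P : pred I) (F : I -> 'M[C]_n) :
  comm_mxd (\sum_(i <- r | P i) F i) X = \sum_(i <- r | P i) comm_mxd (F i) X.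
Proof. by rewrite /comm_mxd mulmx_sumr mulmx_suml -sumrB. Qed.

Lemma comm_mxdZl X c Y : comm_mxd (c *: X) Y = c *: comm_mxd X Y.
Proof. by rewrite /comm_mxd -scalemxAr -scalemxAl scalerBr. Qed.

Lemma adjmxM X Y : (X *m Y)^t* = Y^t* *m X^t*.
Proof. by rewrite trmx_mul map_mxM. Qed.

Lemma adjmx_sum (I : Type) (r : seq I) (P : pred I) (F : I -> 'M[C]_n) :
  (\sum_(i <- r | P i) F i)^t* = \sum_(i <- r | P i) (F i)^t*.
Proof. by rewrite raddf_sum /= raddf_sum. Qed.

Lemma adjmxZ c X : (c *: X)^t* = c^* *: X^t*.
Proof. by rewrite linearZ /= map_mxZ. Qed.

Lemma scale_diag_conj c (U : 'M[C]_n) (v : 'I_n -> C) :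
  c *: (U^t* *m diag_mx (\row_i v i) *m U) = U^t* *m diag_mx (\row_i (c * v i)) *m U.
Proof.
rewrite scalemxAl scalemxAr; congr (_ *m _ *m _).
by apply/matrixP => i j; rewrite !mxE mulrnAr.
Qed.

Lemma diag_pow_conj (U : 'M[C]_n) (e : 'I_n -> C) k :
  U \is unitarymx ->
  iter k (mulmx (U^t* *m diag_mx (\row_i e i) *m U)) 1%:M =
  U^t* *m diag_mx (\row_i e i ^+ k) *m U.
Proof.
move=> hU; elim: k => [|k IH] /=.
  have -> : diag_mx (\row_i e i ^+ 0) = 1%:M :> 'M[C]_n.
    by apply/matrixP => i j; rewrite !mxE.
  by rewrite mulmx1; apply/esym/mulmx1C/unitarymxP.
have -> : diag_mx (\row_i e i ^+ k.+1) =
    diag_mx (\row_i e i) *m diag_mx (\row_i e i ^+ k) :> 'M[C]_n.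
  by rewrite mul_diag_mx; apply/matrixP => i j; rewrite !mxE mulrnAr exprS.
by rewrite IH !mulmxA mulmxtVK.
Qed.

Variables (U H W : 'M[C]_n) (E w : 'I_n -> C) (beta : C).
Hypothesis U_unitary : U \is unitarymx.
Hypothesis H_diag : H = U^t* *m diag_mx (\row_i E i) *m U.
Hypothesis W_diag : W = U^t* *m diag_mx (\row_i w i) *m U.
Hypothesis w_ge0 : forall k, 0 <= w k.
Hypothesis beta_ge0 : 0 <= beta.

(** Matrix of [X] in the common eigenbasis of [H] and [W]. *)
Let rot X := U *m X *m U^t*.

Let rotM X Y : rot (X *m Y) = rot X *m rot Y.
Proof. by rewrite /rot !mulmxA mulmxKtV. Qed.

Let rot_herm X : X^t* = X -> forall i j, rot X j i = (rot X i j)^*.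
Proof.
move=> hX i j; have e : (rot X)^t* = rot X by rewrite /rot !adjmxM trmxCK hX mulmxA.
by rewrite -{1}e !mxE.
Qed.

Let UUt : U *m U^t* = 1%:M. Proof. exact/unitarymxP. Qed.

Let rotH : rot H = diag_mx (\row_i E i).
Proof. by rewrite /rot H_diag !mulmxA UUt mul1mx -mulmxA UUt mulmx1. Qed.

Lemma trace_state X : \tr (W *m X) = \sum_k w k * rot X k k.
Proof.
rewrite W_diag -!mulmxA mxtrace_mulC -!mulmxA [U *m (X *m _)]mulmxA -/(rot X).
by rewrite mul_diag_mx; apply: eq_bigr => k _; rewrite !mxE.
Qed.

Lemma trace_state_mul X Y :
  \tr (W *m (X *m Y)) = \sum_k \sum_j w k * (rot X k j * rot Y j k).
Proof.
by rewrite trace_state; apply: eq_bigr => k _; rewrite rotM mxE mulr_sumr.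
Qed.

Lemma trace_state_square X : X^t* = X ->
  \tr (W *m (X *m X)) = \sum_k \sum_j w k * `|rot X k j| ^+ 2.
Proof.
move=> hX; rewrite trace_state_mul; apply: eq_bigr => k _; apply: eq_bigr => j _.
by rewrite (rot_herm hX k j) normCK.
Qed.

Lemma state_square_ge0 X : X^t* = X -> 0 <= \tr (W *m (X *m X)).
Proof.
move=> hX; rewrite trace_state_square //; apply: sumr_ge0 => k _.
by apply: sumr_ge0 => j _; rewrite mulr_ge0 ?exprn_ge0.
Qed.

(** Cauchy-Schwarz in additive form: since [rot Y j k] and [rot Y k j] have the same modulus, both
    factors carry the weight [w k], and the arithmetic-geometric mean applies to each entry. *)
Lemma state_cauchy X Y : X^t* = X -> Y^t* = Y ->
  2 * `|\tr (W *m (X *m Y))| <= \tr (W *m (X *m X)) + \tr (W *m (Y *m Y)).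
Proof.
move=> hX hY; rewrite trace_state_mul !trace_state_square // -big_split /=.
apply: le_trans (_ : 2 * \sum_k \sum_j `|w k * (rot X k j * rot Y j k)| <= _).
  rewrite ler_pM2l //; apply: le_trans (ler_norm_sum _ _ _) _.
  by apply: ler_sum => k _; exact: ler_norm_sum.
rewrite mulr_sumr; apply: ler_sum => k _; rewrite mulr_sumr -big_split /=.
apply: ler_sum => j _; rewrite (rot_herm hY k j) !normrM norm_conjC ger0_norm //.
rewrite -mulrDr mulrCA ler_wpM2l // -subr_ge0.
set r := (X in 0 <= X); have -> : r = (`|rot X k j| - `|rot Y k j|) ^+ 2 by rewrite /r; ring.
by rewrite -realEsqr rpredB ?normr_real.
Qed.

(** Square roots of [p] and [q] are avoided: both sides are squared, [z ^+ 2] is replaced by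
    [p * q], and the remaining gap is a perfect square. *)
Let am_gm (p q x y z : C) : 0 <= p -> 0 <= q -> 0 <= x -> 0 <= y -> 0 <= z ->
  z ^+ 2 <= p * q -> 2 * (z * (x * y)) <= p * x ^+ 2 + q * y ^+ 2.
Proof.
move=> p0 q0 x0 y0 z0 hz.
rewrite -ler_sqr ?nnegrE ?addr_ge0 ?mulr_ge0 ?exprn_ge0 //.
apply: le_trans (_ : 4 * ((p * q) * (x * y) ^+ 2) <= _).
  rewrite (_ : (2 * (z * (x * y))) ^+ 2 = 4 * (z ^+ 2 * (x * y) ^+ 2)); last by ring.
  by rewrite ler_pM2l // ler_wpM2r // exprn_ge0 // mulr_ge0.
rewrite -subr_ge0.
set r := (X in 0 <= X); have -> : r = (p * x ^+ 2 - q * y ^+ 2) ^+ 2 by rewrite /r; ring.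
by rewrite -realEsqr rpredB // ger0_real // mulr_ge0 ?exprn_ge0.
Qed.

Hypothesis w_real_mono : forall k j, 0 <= (w k - w j) * (E j - E k).
Hypothesis w_lip : forall k j,
  `|w k - w j| ^+ 2 <= ((w k - w j) * (E j - E k)) * (beta * (w k + w j)).

(** In the eigenbasis, exchanging the summation indices gives the pair [(k, j)] the weight
    [w k - w j] in the commutator, [(w k - w j) * (E j - E k)] in the double commutator, and
    [w k + w j] in twice the expectation of A^2. By [w_lip] the square of the first is at most
    [beta] times the product of the other two, so [am_gm] applies entry by entry. *)
Lemma bogoliubov X A : X^t* = X -> A^t* = A ->
  2 * `|\tr (W *m comm_mxd X A)| <=
  \tr (W *m comm_mxd X (comm_mxd H X)) + 2 * beta * \tr (W *m (A *m A)).
Proof.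
move=> hX hA.
have swap F : \sum_k \sum_j F k j = \sum_(k < n) \sum_(j < n) (F j k : C).
  by rewrite exchange_big.
have e1 : \tr (W *m comm_mxd X A) =
    \sum_k \sum_j (w k - w j) * (rot X k j * rot A j k).
  rewrite /comm_mxd mulmxBr raddfB /= !trace_state_mul.
  rewrite [X in _ - X]swap -sumrB; apply: eq_bigr => k _; rewrite -sumrB.
  by apply: eq_bigr => j _; ring.
have e2 : \tr (W *m comm_mxd X (comm_mxd H X)) =
    \sum_k \sum_j ((w k - w j) * (E j - E k)) * `|rot X k j| ^+ 2.
  have rH k j : rot (comm_mxd H X) k j = (E k - E j) * rot X k j.
    rewrite /comm_mxd /rot mulmxBr mulmxBl -!/(rot _) !rotM rotH.
    by rewrite mul_diag_mx mul_mx_diag !mxE; ring.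
  rewrite {1}/comm_mxd mulmxBr raddfB /= !trace_state_mul.
  rewrite [X in _ - X]swap -sumrB; apply: eq_bigr => k _; rewrite -sumrB.
  by apply: eq_bigr => j _; rewrite !rH normCK -(rot_herm hX k j); ring.
have e3 : 2 * \tr (W *m (A *m A)) =
    \sum_k \sum_j (w k + w j) * `|rot A k j| ^+ 2.
  rewrite mulr_natl mulr2n {2}trace_state_square // [X in _ + X]swap.
  rewrite trace_state_square // -big_split; apply: eq_bigr => k _ /=.
  rewrite -big_split; apply: eq_bigr => j _ /=.
  by rewrite (rot_herm hA k j) norm_conjC -mulrDl.
rewrite e1 e2 [2 * beta]mulrC -mulrA e3 mulr_sumr -big_split /=.
apply: le_trans (_ : 2 * \sum_k \sum_j `|(w k - w j) * (rot X k j * rot A j k)| <= _).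
  rewrite ler_pM2l //; apply: le_trans (ler_norm_sum _ _ _) _.
  by apply: ler_sum => k _; exact: ler_norm_sum.
rewrite mulr_sumr; apply: ler_sum => k _; rewrite !mulr_sumr -big_split /=.
apply: ler_sum => j _; rewrite (rot_herm hA k j) !normrM norm_conjC.
rewrite [beta * _]mulrA; apply: am_gm => //.
by rewrite mulr_ge0 ?addr_ge0.
Qed.

End MatrixState.

(** * Normalised thermal expectations *)

Section Thermal.
Local Open Scope sesquilinear_scope.
Variables (C : numClosedFieldType) (n : nat).
Implicit Types (X Y A : 'M[C]_n).

(* [W] plays the role of exp(- beta H); the two pairwise inequalities are all
   that the Bogoliubov inequality uses of the relation w = exp(- beta E). *)
Definition thermal (beta : C) (H W : 'M[C]_n) : Prop :=
  exists (U : 'M[C]_n) (E w : 'I_n -> C),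
    [/\ U \is unitarymx,
        H = U^t* *m diag_mx (\row_i E i) *m U,
        W = U^t* *m diag_mx (\row_i w i) *m U,
        forall k, 0 < w k &
        forall k j, 0 <= (w k - w j) * (E j - E k) /\
          `|w k - w j| ^+ 2 <= ((w k - w j) * (E j - E k)) * (beta * (w k + w j))].

Definition state (W X : 'M[C]_n) : C := \tr (W *m X) / \tr W.

Variables (beta : C) (H W : 'M[C]_n).
Hypotheses (n_gt0 : (0 < n)%N) (beta_ge0 : 0 <= beta) (WH : thermal beta H W).

Lemma thermal_trace_gt0 : 0 < \tr W.
Proof.
case: WH => U [E [w [hU _ hW w_gt0 _]]].
rewrite hW mxtrace_mulC mulmxA (unitarymxP _) // mul1mx mxtrace_diag.
rewrite (eq_bigr w) => [|i _]; last by rewrite mxE.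
rewrite (bigD1 (Ordinal n_gt0)) //= ltr_wpDr // sumr_ge0 // => i _.
exact: ltW.
Qed.

Lemma stateD X Y : state W (X + Y) = state W X + state W Y.
Proof. by rewrite /state mulmxDr raddfD mulrDl. Qed.

Lemma stateB X Y : state W (X - Y) = state W X - state W Y.
Proof. by rewrite /state mulmxBr raddfB mulrBl. Qed.

Lemma stateZ c X : state W (c *: X) = c * state W X.
Proof. by rewrite /state -scalemxAr linearZ mulrA. Qed.

Lemma state_sum (I : Type) (r : seq I) (P : pred I) (F : I -> 'M[C]_n) :
  state W (\sum_(i <- r | P i) F i) = \sum_(i <- r | P i) state W (F i).
Proof. by rewrite /state mulmx_sumr raddf_sum mulr_suml. Qed.

Lemma state_scalar c : state W c%:M = c.
Proof.
by rewrite /state mul_mx_scalar linearZ /= mulfK // lt0r_neq0 // thermal_trace_gt0.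
Qed.

Lemma thermal_square_ge0 X : X^t* = X -> 0 <= state W (X *m X).
Proof.
move=> hX; apply: divr_ge0; last exact/ltW/thermal_trace_gt0.
case: WH => U [E [w [hU _ hW w_gt0 _]]].
by apply: (state_square_ge0 hU hW _ hX) => k; exact: ltW.
Qed.

Lemma thermal_cauchy X Y : X^t* = X -> Y^t* = Y ->
  2 * `|state W (X *m Y)| <= state W (X *m X) + state W (Y *m Y).
Proof.
move=> hX hY; have Z0 := thermal_trace_gt0.
rewrite /state normrM normfV (gtr0_norm Z0) mulrA -mulrDl ler_pM2r ?invr_gt0 //.
case: WH => U [E [w [hU _ hW w_gt0 _]]].
by apply: (state_cauchy hU hW _ hX hY) => k; exact: ltW.
Qed.

Lemma thermal_bogoliubov X A : X^t* = X -> A^t* = A ->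
  2 * `|state W (comm_mxd X A)| <=
  state W (comm_mxd X (comm_mxd H X)) + 2 * beta * state W (A *m A).
Proof.
move=> hX hA; have Z0 := thermal_trace_gt0.
rewrite /state normrM normfV (gtr0_norm Z0) !mulrA -mulrDl ler_pM2r ?invr_gt0 //.
case: WH => U [E [w [hU hH hW w_gt0 hw]]].
by apply: (bogoliubov hU hH hW _ beta_ge0 _ _ hX hA) => k;
  [exact: ltW | move=> j; case: (hw k j)..].
Qed.

End Thermal.

(** * Commutators for the Heisenberg Hamiltonian *)

Section HeisenbergHamiltonian.
Local Open Scope sesquilinear_scope.

(** A product of two Hermitian matrices is Hermitian exactly when they commute, hence the
    commutation hypothesis along bonds. *)
Lemma heisenberg_herm (C : numClosedFieldType) (n : nat) (V : finType)
    (sa sb sc : V -> 'M[C]_n) (adj : rel V) (sigma : V -> C) (B : C) (H : 'M[C]_n) :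
  (forall x, (sa x)^t* = sa x) -> (forall x, (sb x)^t* = sb x) ->
  (forall x, (sc x)^t* = sc x) ->
  (forall x y, adj x y -> [/\ sa x *m sa y = sa y *m sa x,
     sb x *m sb y = sb y *m sb x & sc x *m sc y = sc y *m sc x]) ->
  H = 2^-1 *: (\sum_x \sum_(y | adj x y)
    (sa x *m sa y + sb x *m sb y + sc x *m sc y)) - B *: \sum_x sigma x *: sc x ->
  (forall x, (sigma x)^* = sigma x) -> B^* = B -> H^t* = H.
Proof.
move=> ha hb hc hcomm -> hs hB.
have adjB (X Y : 'M[C]_n) : (X - Y)^t* = X^t* - Y^t* by rewrite !raddfB.
have adjD (X Y : 'M[C]_n) : (X + Y)^t* = X^t* + Y^t* by rewrite !raddfD.
rewrite adjB !adjmxZ !adjmx_sum hB fmorphV rmorph_nat; congr (_ *: _ - _ *: _).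
  apply: eq_bigr => x _; rewrite adjmx_sum; apply: eq_bigr => y /hcomm [ea eb ec].
  by rewrite !adjD !adjmxM !ha !hb !hc ea eb ec.
by apply: eq_bigr => x _; rewrite adjmxZ hc hs.
Qed.

End HeisenbergHamiltonian.

(** * The Bogoliubov inequality for a Heisenberg model on a finite graph *)

Section HeisenbergEstimate.
Local Open Scope sesquilinear_scope.
Variables (C : numClosedFieldType) (n : nat) (V : finType).
Variables (sa sb sc : V -> 'M[C]_n) (adj : rel V) (sigma : V -> C).
Variables (kappa beta B : C) (H W : 'M[C]_n).
Hypotheses (sa_herm : forall x, (sa x)^t* = sa x) (sb_herm : forall x, (sb x)^t* = sb x)
  (sc_herm : forall x, (sc x)^t* = sc x).
Hypothesis comm_aa : forall z x, comm_mxd (sa z) (sa x) = 0.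
Hypothesis comm_ab : forall z x, comm_mxd (sa z) (sb x) = if z == x then 'i *: sc x else 0.
Hypothesis comm_ac : forall z x, comm_mxd (sa z) (sc x) = if z == x then - 'i *: sb x else 0.
Hypothesis casimir : forall x, sa x *m sa x + sb x *m sb x + sc x *m sc x = kappa%:M.
Hypothesis H_def : H = 2^-1 *: (\sum_x \sum_(y | adj x y)
    (sa x *m sa y + sb x *m sb y + sc x *m sc y)) - B *: \sum_x sigma x *: sc x.
Hypothesis sigma_real : forall x, (sigma x)^* = sigma x.
Hypothesis sigma_norm : forall x, `|sigma x| = 1.
Hypotheses (n_gt0 : (0 < n)%N) (B_ge0 : 0 <= B) (beta_ge0 : 0 <= beta).
Hypothesis WH : thermal beta H W.
Local Notation st := (state W).

Let casimir_st x : st (sa x *m sa x) + st (sb x *m sb x) + st (sc x *m sc x) = kappa.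
Proof. by rewrite -!stateD casimir (state_scalar n_gt0 WH). Qed.

Let sq_ge0 X : X^t* = X -> 0 <= st (X *m X).
Proof. exact: (thermal_square_ge0 n_gt0 WH). Qed.

(** The three non-negative second moments at a site add up to the Casimir value [kappa], so each is
    at most [kappa]; Cauchy-Schwarz does the rest. *)
Lemma transverse_corr_bound x y : `|st (sb x *m sb y)| <= kappa.
Proof.
rewrite -(ler_pM2l (ltr0Sn C 1)); apply: le_trans (thermal_cauchy n_gt0 WH _ _) _ => //.
rewrite mulr_natl mulr2n; apply: lerD.
  by rewrite -(casimir_st x) addrAC lerDr addr_ge0 ?sq_ge0.
by rewrite -(casimir_st y) addrAC lerDr addr_ge0 ?sq_ge0.
Qed.

(** The second moments of [sb] and [sc] at one site share the budget [kappa], so two correlations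
    together obey the same bound as one. *)
Let exchange_bound x y : `|st (sb x *m sb y + sc x *m sc y)| <= kappa.
Proof.
rewrite stateD; apply: le_trans (ler_normD _ _) _.
rewrite -(ler_pM2l (ltr0Sn C 1)) mulrDr.
apply: le_trans (lerD (thermal_cauchy n_gt0 WH (sb_herm x) (sb_herm y))
  (thermal_cauchy n_gt0 WH (sc_herm x) (sc_herm y))) _.
rewrite addrACA mulr_natl mulr2n; apply: lerD.
  by rewrite -(casimir_st x) -addrA lerDr sq_ge0.
by rewrite -(casimir_st y) -addrA lerDr sq_ge0.
Qed.

Let kappa_ge0 (x : V) : 0 <= kappa.
Proof. by apply: le_trans (transverse_corr_bound x x). Qed.

(** Cauchy-Schwarz against the identity. The constant is crude, but it multiplies only the field
    term, which disappears with the field. *)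
Lemma sc_bound x : `|st (sc x)| <= kappa + 1.
Proof.
have h1 : (1%:M : 'M[C]_n)^t* = 1%:M by rewrite trmx1 map_mx1.
have := thermal_cauchy n_gt0 WH (sc_herm x) h1; rewrite !mulmx1 (state_scalar n_gt0 WH) => h.
have k0 := kappa_ge0 x.
rewrite -(ler_pM2l (ltr0Sn C 1)); apply: le_trans h _.
rewrite mulr_natl mulr2n ler_wpDl ?addr_ge0 // lerD2r.
by rewrite -(casimir_st x) lerDr addr_ge0 ?sq_ge0.
Qed.

Variables (f : V -> C) (J : finType) (e : J -> V).
Hypothesis f_real : forall x, (f x)^* = f x.
(** [gen] and [trial] are the operators C and A of the inequality. In the application [V] is the
    large box, [e] embeds the smaller box [J], and [f] is t times the tent. *)
Let gen : 'M[C]_n := \sum_z f z *: sa z.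
Let trial : 'M[C]_n := \sum_(j : J) sigma (e j) *: sb (e j).

Let gen_herm : gen^t* = gen.
Proof.
by rewrite adjmx_sum; apply: eq_bigr => z _; rewrite adjmxZ sa_herm f_real.
Qed.

Let trial_herm : trial^t* = trial.
Proof.
by rewrite adjmx_sum; apply: eq_bigr => z _; rewrite adjmxZ sb_herm sigma_real.
Qed.

Let der := comm_mxd gen.

Let der_a x : der (sa x) = 0.
Proof.
rewrite /der comm_mxd_suml big1 // => z _.
by rewrite comm_mxdZl comm_aa scaler0.
Qed.

Let der_b x : der (sb x) = (f x * 'i) *: sc x.
Proof.
rewrite /der comm_mxd_suml (bigD1 x) //= comm_mxdZl comm_ab eqxx scalerA.
by rewrite big1 ?addr0 // => z /negPf zx; rewrite comm_mxdZl comm_ab zx scaler0.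
Qed.

Let der_c x : der (sc x) = - (f x * 'i) *: sb x.
Proof.
rewrite /der comm_mxd_suml (bigD1 x) //= comm_mxdZl comm_ac eqxx scalerA mulrN.
by rewrite big1 ?addr0 // => z /negPf zx; rewrite comm_mxdZl comm_ac zx scaler0.
Qed.

Let derD X Y : der (X + Y) = der X + der Y.
Proof. by rewrite /der /comm_mxd mulmxDl mulmxDr opprD addrACA. Qed.

(** [gen] rotates the pair [sb x], [sc x] with angular velocity [f x]. A bond is invariant under a
    common rotation, so each commutator brings out one factor [f x - f y]; the intermediate result
    is the spin current through the bond. *)
Let der2_bond x y :
  der (der (sa x *m sa y + sb x *m sb y + sc x *m sc y)) =
  (f x - f y) ^+ 2 *: (sb x *m sb y + sc x *m sc y).
Proof.
have -> : der (sa x *m sa y + sb x *m sb y + sc x *m sc y) =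
    ('i * (f x - f y)) *: (sc x *m sb y - sb x *m sc y).
  rewrite !derD /der !comm_mxdM -!/(der _) !der_a !der_b !der_c mul0mx mulmx0 !add0r.
  rewrite -!scalemxAl -!scalemxAr.
  move: (sc x *m sb y) (sb x *m sc y) => X Y.
  by apply/matrixP => i j; rewrite !mxE; ring.
rewrite /der comm_mxdZ comm_mxdB !comm_mxdM -!/(der _) !der_b !der_c.
rewrite -!scalemxAl -!scalemxAr.
move: (sc x *m sc y) (sb x *m sb y) => X Y.
apply/matrixP => i j; rewrite !mxE.
transitivity (- ('i * 'i) * ((f x - f y) ^+ 2 * (X i j + Y i j))); first by ring.
by rewrite -expr2 sqrCi; ring.
Qed.

Let der2_field x : der (der (sc x)) = f x ^+ 2 *: sc x.
Proof.
rewrite der_c /der comm_mxdZ -/(der _) der_b scalerA; congr (_ *: _).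
transitivity (- ('i * 'i) * f x ^+ 2); first by ring.
by rewrite -expr2 sqrCi; ring.
Qed.

Let double_comm : comm_mxd gen (comm_mxd H gen) =
  B *: (\sum_x (sigma x * f x ^+ 2) *: sc x) -
  2^-1 *: (\sum_x \sum_(y | adj x y) (f x - f y) ^+ 2 *: (sb x *m sb y + sc x *m sc y)).
Proof.
have -> : comm_mxd H gen = - der H by rewrite /der /comm_mxd opprB.
have -> : comm_mxd gen (- der H) = - der (der H) by rewrite -scaleN1r comm_mxdZ scaleN1r.
rewrite H_def {2}/der comm_mxdB !comm_mxdZ /der comm_mxdB !comm_mxdZ opprB.
congr (_ *: _ - _ *: _).
  rewrite !comm_mxd_sum; apply: eq_bigr => x _.
  by rewrite !comm_mxdZ -/(der (sc x)) -/(der (der _)) der2_field scalerA.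
rewrite !comm_mxd_sum; apply: eq_bigr => x _; rewrite !comm_mxd_sum.
by apply: eq_bigr => y _; rewrite -/(der _) -/(der (der _)) der2_bond.
Qed.

Lemma heisenberg_bogoliubov :
  2 * `|\sum_j f (e j) * (sigma (e j) * st (sc (e j)))| <=
  2^-1 * (kappa * \sum_x \sum_(y | adj x y) (f x - f y) ^+ 2) +
  B * ((kappa + 1) * \sum_x f x ^+ 2) +
  2 * beta * \sum_j \sum_l sigma (e j) * sigma (e l) * st (sb (e j) *m sb (e l)).
Proof.
have f2_ge0 u v : 0 <= (f u - f v) ^+ 2.
  by rewrite -realEsqr; apply/CrealP; rewrite rmorphB /= !f_real.
have f1_ge0 u : 0 <= f u ^+ 2 by rewrite -realEsqr; apply/CrealP; rewrite f_real.
have -> : \sum_j \sum_l sigma (e j) * sigma (e l) * st (sb (e j) *m sb (e l)) =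
    st (trial *m trial).
  rewrite /trial mulmx_suml state_sum; apply: eq_bigr => j _.
  rewrite mulmx_sumr state_sum; apply: eq_bigr => l _.
  by rewrite -scalemxAl -scalemxAr !stateZ mulrA.
have -> : `|\sum_j f (e j) * (sigma (e j) * st (sc (e j)))| = `|st (comm_mxd gen trial)|.
  rewrite /trial comm_mxd_sum state_sum.
  transitivity (`|'i * \sum_j f (e j) * (sigma (e j) * st (sc (e j)))|).
    by rewrite normrM normCi mul1r.
  congr (`|_|); rewrite mulr_sumr; apply: eq_bigr => j _.
  by rewrite comm_mxdZ -/(der _) der_b !stateZ; ring.
have b := thermal_bogoliubov n_gt0 beta_ge0 WH gen_herm trial_herm.
have tg := sq_ge0 trial_herm.
(* In the order of a complex field, [x <= y] makes [y - x] real. The lower bound here is real, so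
   the double commutator has a real expectation and may be replaced by its modulus, to which the
   triangle inequality applies. *)
have D_real : 2 * `|st (comm_mxd gen trial)| - 2 * beta * st (trial *m trial) <=
   `|st (comm_mxd gen (comm_mxd H gen))|.
  have b' : 2 * `|st (comm_mxd gen trial)| - 2 * beta * st (trial *m trial) <=
      st (comm_mxd gen (comm_mxd H gen)) by rewrite lerBlDr.
  have r : st (comm_mxd gen (comm_mxd H gen)) \is Num.real.
    rewrite -[X in X \is _](subrK (2 * `|st (comm_mxd gen trial)| - 2 * beta * st (trial *m trial))).
    apply: rpredD; first by rewrite ger0_real ?subr_ge0.
    apply: rpredB; rewrite ger0_real //.
    by apply: mulr_ge0 => //; exact: mulr_ge0.
  exact: le_trans b' (real_ler_norm r).
rewrite -lerBlDr; apply: le_trans D_real _.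
rewrite double_comm stateB !stateZ !state_sum.
apply: le_trans (ler_normB _ _) _; rewrite addrC; apply: lerD.
  rewrite normrM ger0_norm ?invr_ge0 // ler_pM2l ?invr_gt0 //.
  rewrite mulr_sumr; apply: le_trans (ler_norm_sum _ _ _) _.
  apply: ler_sum => x _; rewrite state_sum mulr_sumr.
  apply: le_trans (ler_norm_sum _ _ _) _; apply: ler_sum => y _.
  by rewrite stateZ normrM ger0_norm // mulrC ler_wpM2r.
rewrite normrM ger0_norm // ler_wpM2l // mulr_sumr.
apply: le_trans (ler_norm_sum _ _ _) _; apply: ler_sum => x _.
rewrite stateZ normrM [`|sigma x * _|]normrM sigma_norm mul1r (ger0_norm (f1_ge0 x)).
by rewrite mulrC; apply: ler_wpM2r => //; exact: sc_bound.
Qed.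

End HeisenbergEstimate.

Local Open Scope complex_scope.

(** * Spin matrices *)

Section SpinMatrices.
Variables (R : realType) (twoS : nat).
Local Notation C := R[i].
Local Notation ii := ('i%R : R[i]).
Local Notation Sx := (@Sx R twoS).
Local Notation Sy := (@Sy R twoS).
Local Notation Sz := (@Sz R twoS).
Local Notation Splus := (@Splus R twoS).
Local Notation Sminus := (@Sminus R twoS).
Local Notation smat := (smat R twoS).
Local Notation spin := (spinS R twoS).
Local Notation mval := (@mval R twoS).
Local Notation spinM := 'M[C]_twoS.+1.

Definition spin_mx (a : smat) : spinM := \matrix_(i, j) a i j.
Definition smul (a b : smat) : smat := fun m' m => \sum_k a m' k * b k m.

Let casimir : R := spin * (spin + 1).
Let rung (m : 'I_twoS.+1) : R := Num.sqrt (casimir - mval m * (mval m + 1)).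

Let mval_up (m' m : 'I_twoS.+1) : (mval m' == mval m + 1) = (m'.+1 == m :> nat).
Proof.
rewrite -(eqr_nat R) /mval -natr1 -subr_eq0 -[RHS]subr_eq0 -oppr_eq0.
by congr (_ == _); ring.
Qed.

Let SplusE m' m : Splus m' m = if (m'.+1 == m :> nat) then (rung m)%:C else 0.
Proof. by rewrite /Splus mval_up. Qed.

Let mval_down (m' m : 'I_twoS.+1) : (mval m' == mval m - 1) = (m.+1 == m' :> nat).
Proof. by rewrite -mval_up -[RHS]eq_sym -subr_eq opprK eq_sym -subr_eq. Qed.

Let SminusE m' m : Sminus m' m = if (m.+1 == m' :> nat) then (rung m')%:C else 0.
Proof.
rewrite /Sminus mval_down; case: ifP => //; rewrite -mval_up => /eqP e.
by congr (Num.sqrt _)%:C; rewrite e /casimir; ring.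
Qed.

Let rung_sq m : rung m ^+ 2 = casimir - mval m * (mval m + 1).
Proof.
rewrite sqr_sqrtr //.
(* With M = S - m, the number S(S+1) - M(M+1) factors as (S-M)(S+M+1), which is visibly
   non-negative. *)
have -> : casimir - mval m * (mval m + 1) = m%:R * (twoS.+1 - m)%:R.
  by rewrite natrB ?(ltnW (ltn_ord m)) // -natr1 /casimir /mval /spinS; field.
by rewrite mulr_ge0.
Qed.

Let rungC m : (rung m)%:C * (rung m)%:C = (casimir - mval m * (mval m + 1))%:C.
Proof. by rewrite -rmorphM /= -expr2 rung_sq. Qed.

Let raise_lower : spin_mx Splus * spin_mx Sminus =
  diag_mx (\row_i (casimir - mval i * (mval i - 1))%:C).
Proof.
apply/matrixP => i j; rewrite !mxE.
under eq_bigr => k _ do rewrite !mxE SplusE SminusE.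
have [ij|ij] := eqVneq i j; last first.
  rewrite mulr0n big1 // => k _; case: eqP => [ik|]; last by rewrite mul0r.
  case: eqP => [jk|]; last by rewrite mulr0.
  by case/eqP: ij; apply/val_inj/succn_inj; rewrite ik jk.
rewrite mulr1n -ij; have [lt_i|le_i] := ltnP i.+1 twoS.+1.
  rewrite (bigD1 (Ordinal lt_i)) //= eqxx big1 => [|k]; last first.
    by rewrite -val_eqE /= eq_sym => /negPf ->; rewrite mul0r.
  rewrite addr0 rungC; congr (_%:C).
  by rewrite /mval /= -natr1; ring.
(* At the lowest weight M = -S there is no state below, and the diagonal coefficient vanishes as
   well. *)
rewrite big1 => [|k _]; last first.
  by case: eqP => [e|]; [have := ltn_ord k; rewrite -e ltnNge le_i | rewrite mul0r].
have -> : mval i = - spin.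
  have e : nat_of_ord i = twoS by apply/eqP; rewrite eqn_leq -ltnS ltn_ord.
  by rewrite /mval e /spinS; field.
by rewrite -[LHS](rmorph0 (real_complex R)); congr (_%:C); rewrite /casimir; ring.
Qed.

Let lower_raise : spin_mx Sminus * spin_mx Splus =
  diag_mx (\row_i (casimir - mval i * (mval i + 1))%:C).
Proof.
apply/matrixP => i j; rewrite !mxE.
under eq_bigr => k _ do rewrite !mxE SplusE SminusE.
have [ij|ij] := eqVneq i j; last first.
  rewrite mulr0n big1 // => k _; case: eqP => [ik|]; last by rewrite mul0r.
  case: eqP => [jk|]; last by rewrite mulr0.
  by case/eqP: ij; apply/val_inj; rewrite /= -ik.
rewrite mulr1n -ij; case: (posnP i) => [i0|i_gt0].
  rewrite big1 => [|k _]; last by rewrite i0 mul0r.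
  have -> : mval i = spin by rewrite /mval i0 subr0.
  by rewrite -[LHS](rmorph0 (real_complex R)); congr (_%:C); rewrite /casimir; ring.
have lt_i : (i.-1 < twoS.+1)%N by rewrite (leq_ltn_trans (leq_pred _)).
rewrite (bigD1 (Ordinal lt_i)) //= prednK // eqxx big1 => [|k]; last first.
  rewrite -val_eqE /= => /negPf hk; case: eqP => [e|]; last by rewrite mul0r.
  by rewrite -e eqxx in hk.
by rewrite addr0 rungC.
Qed.

Let SzE : spin_mx Sz = diag_mx (\row_i (mval i)%:C).
Proof. by apply/matrixP => i j; rewrite !mxE /Sz; case: eqP => // ->. Qed.

Let SxE : spin_mx Sx = 2^-1 *: (spin_mx Splus + spin_mx Sminus).
Proof. by apply/matrixP => i j; rewrite !mxE /Sx mulrC. Qed.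

Let SyE : spin_mx Sy = (2 * ii)^-1 *: (spin_mx Splus - spin_mx Sminus).
Proof. by apply/matrixP => i j; rewrite !mxE /Sy mulrC. Qed.

Let i2 : ii * ii = -1 :> C. Proof. by rewrite -expr2 sqrCi. Qed.
Let i_neq0 : ii != 0 :> C. Proof. by rewrite neq0Ci. Qed.

Let Sz_comm : spin_mx Splus * spin_mx Sminus - spin_mx Sminus * spin_mx Splus =
  2 *: spin_mx Sz.
Proof.
rewrite raise_lower lower_raise SzE; apply/matrixP => i j; rewrite !mxE.
case: eqP => _; rewrite ?mulr0n ?mulr1n ?mulr0 ?subr0 //.
by rewrite !(rmorphB, rmorphM, rmorphD, rmorph1) /=; ring.
Qed.

Lemma spin_comm_xy : spin_mx Sx * spin_mx Sy - spin_mx Sy * spin_mx Sx = ii *: spin_mx Sz.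
Proof.
have -> : ii *: spin_mx Sz = (2^-1 * (2 * ii)^-1) *: (- (4 *: spin_mx Sz)).
  rewrite -scaleNr scalerA; congr (_ *: _).
  apply: (mulfI i_neq0); rewrite i2.
  by move: i_neq0; move: ii => j j_neq0; field.
rewrite SxE SyE -!scalerAl -!scalerAr !scalerA -[(2 * ii)^-1 * _]mulrC -scalerBr.
congr (_ *: _).
have -> : 4 *: spin_mx Sz = 2 *: (2 *: spin_mx Sz) by rewrite scalerA; congr (_ *: _); ring.
rewrite -Sz_comm !mulrDl !mulrDr !mulNr !mulrN.
move: (_ * spin_mx Splus) (spin_mx Splus * spin_mx Sminus) => A B.
by apply/matrixP => i j; rewrite !mxE; ring.
Qed.

Let Sz_plus : spin_mx Sz * spin_mx Splus - spin_mx Splus * spin_mx Sz = spin_mx Splus.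
Proof.
rewrite SzE; rewrite -[diag_mx _ * _]/(_ *m _) -[_ * diag_mx _]/(_ *m _).
rewrite mul_diag_mx mul_mx_diag; apply/matrixP => i j; rewrite !mxE /Splus.
case: eqP => [->|_]; last by rewrite mulr0 mul0r subrr.
by rewrite rmorphD /=; ring.
Qed.

Let Sz_minus : spin_mx Sz * spin_mx Sminus - spin_mx Sminus * spin_mx Sz = - spin_mx Sminus.
Proof.
rewrite SzE; rewrite -[diag_mx _ * _]/(_ *m _) -[_ * diag_mx _]/(_ *m _).
rewrite mul_diag_mx mul_mx_diag; apply/matrixP => i j; rewrite !mxE /Sminus.
case: eqP => [->|_]; last by rewrite mulr0 mul0r subrr oppr0.
by rewrite rmorphB /=; ring.
Qed.

Lemma spin_comm_xz : spin_mx Sx * spin_mx Sz - spin_mx Sz * spin_mx Sx = - ii *: spin_mx Sy.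
Proof.
have -> : - ii *: spin_mx Sy = 2^-1 *: - (spin_mx Splus - spin_mx Sminus).
  rewrite SyE scalerN -scaleNr scalerA; congr (_ *: _).
  by move: i_neq0; move: ii => j j_neq0; field.
rewrite -[X in _ *: - (X - _)]Sz_plus -[X in _ *: - (_ - X)]opprK -Sz_minus.
rewrite SxE -!scalerAl -!scalerAr -scalerBr; congr (_ *: _).
rewrite !mulrDl !mulrDr; move: (_ * spin_mx Sz) (_ * spin_mx Sz) => A B.
move: (spin_mx Sz * _) (spin_mx Sz * _) => D F.
by apply/matrixP => i j; rewrite !mxE; ring.
Qed.

Lemma spin_casimir :
  spin_mx Sx * spin_mx Sx + spin_mx Sy * spin_mx Sy + spin_mx Sz * spin_mx Sz =
  (spin * (spin + 1))%:C%:M.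
Proof.
rewrite SxE SyE -!scalerAl -!scalerAr !scalerA -!invfM.
have -> : 2 * ii * (2 * ii) = - (2 * 2) :> C by rewrite mulrACA i2 mulrN1.
have e : forall P M : spinM, (2 * 2)^-1 *: ((P + M) * (P + M)) +
    (- (2 * 2))^-1 *: ((P - M) * (P - M)) = 2^-1 *: (P * M + M * P).
  move=> P M; rewrite !mulrDl !mulrDr !mulNr !mulrN opprK.
  move: (P * P) (P * M) (M * P) (M * M) => A B D F.
  by apply/matrixP => i j; rewrite !mxE; field.
rewrite e raise_lower lower_raise SzE -[diag_mx _ * _]/(_ *m _) mul_diag_mx.
apply/matrixP => i j; rewrite !mxE /casimir.
case: eqP => _; rewrite ?mulr0n ?mulr1n ?addr0 ?mulr0 ?addr0 //.
by rewrite !(rmorphB, rmorphM, rmorphD, rmorph1) /=; field.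
Qed.

Let Sminus_tr m' m : Sminus m' m = Splus m m'.
Proof. by rewrite SplusE SminusE. Qed.

Let Splus_conj m' m : (Splus m' m)^*%R = Splus m' m.
Proof. by rewrite SplusE; case: eqP; rewrite ?conjC0 //= => _; exact: conjc_real. Qed.

Lemma Sx_herm m' m : (Sx m' m)^*%R = Sx m m'.
Proof.
by rewrite /Sx !Sminus_tr rmorphM rmorphD fmorphV /= rmorph_nat !Splus_conj [X in X / _]addrC.
Qed.

Lemma Sy_herm m' m : (Sy m' m)^*%R = Sy m m'.
Proof.
rewrite /Sy !Sminus_tr rmorphM rmorphB fmorphV rmorphM /= rmorph_nat !Splus_conj.
by rewrite conjCi mulrN invrN mulrN -mulNr opprB.
Qed.

Lemma Sz_herm m' m : (Sz m' m)^*%R = Sz m m'.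
Proof.
rewrite /Sz eq_sym; case: eqP => [->|_]; last by rewrite conjC0.
exact: conjc_real.
Qed.

Let rev_succ (m' m : 'I_twoS.+1) : ((rev_ord m').+1 == rev_ord m) = (m.+1 == m').
Proof.
by have := ltn_ord m'; have := ltn_ord m; rewrite /= => ? ?; apply/eqP/eqP; lia.
Qed.

Let rung_rev (m' m : 'I_twoS.+1) : m'.+1 = m -> rung (rev_ord m') = rung m.
Proof.
move=> e; congr Num.sqrt; congr (_ - _).
have -> : mval (rev_ord m') = - mval m'.
  by rewrite /mval /= subSS natrB -1?ltnS ?ltn_ord // /spinS; field.
have -> : mval m = mval m' - 1 by rewrite /mval -e -natr1; ring.
by ring.
Qed.

Let Splus_rev m' m : Splus (rev_ord m') (rev_ord m) = Sminus m' m.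
Proof.
rewrite SplusE SminusE rev_succ; case: eqP => // e; congr (_%:C).
exact: rung_rev.
Qed.

Let Sminus_rev m' m : Sminus (rev_ord m') (rev_ord m) = Splus m' m.
Proof. by rewrite -Splus_rev !rev_ordK. Qed.

(** Reversing the basis sends M to -M. Up to a phase this is the rotation by pi about the first
    axis, which fixes that component and negates the other two. *)
Lemma Sx_rev m' m : Sx (rev_ord m') (rev_ord m) = Sx m' m.
Proof. by rewrite /Sx Splus_rev Sminus_rev addrC. Qed.

Lemma Sy_rev m' m : Sy (rev_ord m') (rev_ord m) = - Sy m' m.
Proof. by rewrite /Sy Splus_rev Sminus_rev -mulNr opprB. Qed.

Lemma Sz_rev m' m : Sz (rev_ord m') (rev_ord m) = - Sz m' m.
Proof.
rewrite /Sz (inj_eq rev_ord_inj); case: eqP; rewrite ?oppr0 // => _.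
rewrite -rmorphN /=; congr (_%:C).
by rewrite /mval /= subSS natrB -1?ltnS ?ltn_ord // /spinS; field.
Qed.

End SpinMatrices.

(** * Matrix form of finite-volume Gibbs states *)

Section ThermalState.
Local Open Scope sesquilinear_scope.
Variable R : realType.
Local Notation C := R[i].

Lemma Re_sum (I : Type) (r : seq I) (F : I -> C) :
  complex.Re (\sum_(i <- r) F i) = \sum_(i <- r) complex.Re (F i).
Proof. by elim/big_rec2: _ => //= i x y _ <-; case: (F i) y => ? ? []. Qed.

Lemma Im_sum (I : Type) (r : seq I) (F : I -> C) :
  complex.Im (\sum_(i <- r) F i) = \sum_(i <- r) complex.Im (F i).
Proof. by elim/big_rec2: _ => //= i x y _ <-; case: (F i) y => ? ? []. Qed.

Lemma ReM_real (z : C) (x : R) : complex.Re (z * x%:C) = complex.Re z * x.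
Proof. by case: z => a b /=; rewrite mulr0 subr0. Qed.

Lemma ImM_real (z : C) (x : R) : complex.Im (z * x%:C) = complex.Im z * x.
Proof. by case: z => a b /=; rewrite mulr0 add0r. Qed.

Lemma limn_lincomb (n : nat) (a : 'I_n -> R) (p : 'I_n -> nat -> R) :
  (forall l, cvgn (p l)) ->
  limn (fun k => \sum_l a l * p l k) = \sum_l a l * limn (p l).
Proof.
move=> p_cvg; apply/cvg_lim => //.
apply: cvg_big => [|l _]; first exact: add_continuous.
by apply: cvgMl_tmp; exact: p_cvg.
Qed.

(** [climn] applies the total function [limn] to real and imaginary parts, so linearity has to be
    paid for by convergence of each [p l]. *)
Lemma climn_lincomb (n : nat) (z : 'I_n -> C) (p : 'I_n -> nat -> R) :
  (forall l, cvgn (p l)) ->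
  climn (fun k => \sum_l z l * (p l k)%:C) = \sum_l z l * (limn (p l))%:C.
Proof.
move=> p_cvg; apply/eqP; rewrite eq_complex Re_sum Im_sum /=; apply/andP; split.
  rewrite (eq_bigr _ (fun l _ => ReM_real (z l) (limn (p l)))).
  rewrite -(limn_lincomb (fun l => complex.Re (z l)) p_cvg); apply/eqP.
  congr (limn _); apply/funext => k; rewrite Re_sum.
  by apply: eq_bigr => l _; rewrite ReM_real.
rewrite (eq_bigr _ (fun l _ => ImM_real (z l) (limn (p l)))).
rewrite -(limn_lincomb (fun l => complex.Im (z l)) p_cvg); apply/eqP.
congr (limn _); apply/funext => k; rewrite Im_sum.
by apply: eq_bigr => l _; rewrite ImM_real.
Qed.

Lemma herm_spectral (k : nat) (H : 'M[C]_k) : H^t* = H ->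
  exists (U : 'M[C]_k) (e : 'I_k -> R),
    U \is unitarymx /\ H = U^t* *m diag_mx (\row_i (e i)%:C) *m U.
Proof.
move=> hH; have herm : H \is hermsymmx.
  by apply/is_hermitianmxP; rewrite expr0 scale1r hH.
exists (spectralmx H), (fun i => complex.Re (spectral_diag H 0 i)).
split; first exact: spectral_unitarymx.
rewrite -invmx_unitary ?spectral_unitarymx //.
have -> : \row_i (complex.Re (spectral_diag H 0 i))%:C = spectral_diag H.
  apply/rowP => i; rewrite mxE; apply: RRe_real.
  by have /mxOverP := hermitian_spectral_diag_real herm; apply.
exact/orthomx_spectralP/hermitian_normalmx.
Qed.

Variables (d twoS L : nat).
Local Notation conf := (conf d twoS L).
Local Notation op := (op R d twoS L).
Local Notation n := #|{: conf}|.

(** Enumerating the configurations makes the spectral theorem for matrices available. *)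
Definition opmx (A : op) : 'M[C]_n := \matrix_(i, j) A (enum_val i) (enum_val j).

Lemma opmxM (A B : op) : opmx (opmul A B) = opmx A *m opmx B.
Proof.
apply/matrixP => i j; rewrite !mxE /opmul (reindex _ (onW_bij _ (@enum_val_bij _))) /=.
by apply: eq_bigr => k _; rewrite !mxE.
Qed.

Lemma opmx_id : opmx (@opid R d twoS L) = 1%:M.
Proof. by apply/matrixP => i j; rewrite !mxE /opid (inj_eq enum_val_inj); case: eqP. Qed.

Lemma opmxZ (c : C) (A : op) : opmx (opscale c A) = c *: opmx A.
Proof. by apply/matrixP => i j; rewrite !mxE. Qed.

Lemma trace_opmx (A : op) : trace A = \tr (opmx A).
Proof.
rewrite /trace (reindex _ (onW_bij _ (@enum_val_bij _))) /=.
by apply: eq_bigr => i _; rewrite mxE.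
Qed.

Lemma opmx_pow (A : op) k : opmx (oppow A k) = iter k (mulmx (opmx A)) 1%:M.
Proof. by elim: k => [|k IH] /=; rewrite ?opmx_id // opmxM IH. Qed.

(** After diagonalisation every entry of a partial sum is a fixed linear combination of the real
    exponential series at the eigenvalues, so the entrywise limit is the spectral exponential. *)
Lemma opmx_expm (A : op) (U : 'M[C]_n) (e : 'I_n -> R) :
  U \is unitarymx -> opmx A = U^t* *m diag_mx (\row_i (e i)%:C) *m U ->
  opmx (expm A) = U^t* *m diag_mx (\row_i (expR (e i))%:C) *m U.
Proof.
move=> hU hA; apply/matrixP => i j.
have entry (v : 'I_n -> C) :
    (U^t* *m diag_mx (\row_i v i) *m U) i j = \sum_l (U^t* i l * U l j) * v l.
  rewrite mul_mx_diag mxE; apply: eq_bigr => l _; rewrite !mxE; ring.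
rewrite entry mxE /expm -climn_lincomb; last by move=> l; exact: is_cvg_series_exp_coeff.
congr climn; apply/funext => N.
transitivity (\sum_(k < N) \sum_l (U^t* i l * U l j) * (e l)%:C ^+ k / (k`!)%:R).
  apply: eq_bigr => k _; rewrite -mulr_suml; congr (_ / _).
  have := congr1 (fun M : 'M[C]_n => M i j) (opmx_pow A k); rewrite mxE => ->.
  by rewrite hA diag_pow_conj // entry.
rewrite exchange_big; apply: eq_bigr => l _.
rewrite /series /= big_mkord rmorph_sum mulr_sumr; apply: eq_bigr => k _.
by rewrite -mulrA /exp_coeff /= rmorphM fmorphV rmorphXn /= rmorph_nat.
Qed.

End ThermalState.

(** * Boltzmann weights satisfy the pairwise inequalities *)

Section GenericThermal.
Local Open Scope sesquilinear_scope.
Variable R : realType.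
Local Notation C := R[i].

(** By symmetry a <= b; with u = beta (b - a) everything then follows from 1 - exp(-u) <= u. The
    sharper tanh(u/2) <= u/2 would gain a factor 2, irrelevant for the decay exponent. *)
Lemma exp_gap (beta a b : R) : 0 <= beta ->
  let g := expR (- beta * a) - expR (- beta * b) in
  0 <= g * (b - a) /\
  g ^+ 2 <= g * (b - a) * (beta * (expR (- beta * a) + expR (- beta * b))).
Proof.
move=> beta_ge0 /=.
wlog ab : a b / a <= b.
  move=> h; have [ab|/ltW ba] := leP a b; first exact: h.
  have [h1 h2] := h b a ba; split.
    by move: h1; congr (0 <= _); ring.
  by move: h2; congr (_ <= _); ring.
set wa := expR (- beta * a); set wb := expR (- beta * b).
have wa0 : 0 < wa by exact: expR_gt0.
have wb0 : 0 < wb by exact: expR_gt0.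
have ba0 : 0 <= b - a by rewrite subr_ge0.
have g0 : 0 <= wa - wb.
  by rewrite subr_ge0 ler_expR !mulNr lerN2 ler_wpM2l.
split; first exact: mulr_ge0.
rewrite expr2 -mulrA ler_wpM2l //.
have -> : wb = wa * expR (- (beta * (b - a))) by rewrite -expRD; congr expR; ring.
have h := expR_ge1Dx (- (beta * (b - a))).
have : wa * (1 - expR (- (beta * (b - a)))) <= wa * (beta * (b - a)).
  by rewrite ler_pM2l //; lra.
have : 0 <= beta * (b - a) * (wa * expR (- (beta * (b - a)))).
  by rewrite !mulr_ge0 // ?expR_ge0 // ltW.
nra.
Qed.

Lemma thermal_exp (k : nat) (beta : R) (H W U : 'M[C]_k) (e : 'I_k -> R) : 0 <= beta ->
  U \is unitarymx -> H = U^t* *m diag_mx (\row_i (e i)%:C) *m U ->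
  W = U^t* *m diag_mx (\row_i (expR (- beta * e i))%:C) *m U -> thermal beta%:C H W.
Proof.
move=> beta_ge0 hU hH hW.
exists U, (fun i => (e i)%:C), (fun i => (expR (- beta * e i))%:C); split => //.
  by move=> i; rewrite ltcR expR_gt0.
move=> i j; have [h1 h2] := exp_gap (e i) (e j) beta_ge0.
rewrite -!(rmorphB, rmorphD, rmorphM) /=; split; first by rewrite lecR.
by rewrite normc_def /= expr0n addr0 sqrtr_sqr -rmorphXn /= real_normK ?num_real // lecR.
Qed.

Lemma diag_conjZ (k : nat) (c : R) (H U : 'M[C]_k) (e : 'I_k -> R) :
  H = U^t* *m diag_mx (\row_i (e i)%:C) *m U ->
  c%:C *: H = U^t* *m diag_mx (\row_i (c * e i)%:C) *m U.
Proof.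
move=> ->; rewrite scale_diag_conj; congr (_ *m diag_mx _ *m _).
by apply/rowP => i; rewrite !mxE rmorphM.
Qed.

End GenericThermal.

(** * One-site operators and the Hamiltonian as matrices *)

Section SiteOperators.
Local Open Scope sesquilinear_scope.
Variables (R : realType) (d twoS L : nat).
Local Notation C := R[i].
Local Notation site := (site d L).
Local Notation conf := (conf d twoS L).
Local Notation op := (op R d twoS L).
Local Notation smat := (smat R twoS).
Local Notation n := #|{: conf}|.
Local Notation spinM := 'M[C]_twoS.+1.

Definition upd (s : conf) (x : site) (k : 'I_twoS.+1) : conf :=
  [ffun y => if y == x then k else s y].

(** Only intermediate configurations equal to [s] off [x] contribute: one [upd s x k] for each value
    [k] at [x]. *)
Lemma at_siteM x (a b : smat) (s t : conf) :
  opmul (at_site x a) (at_site x b) s t = at_site x (smul a b) s t.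
Proof.
rewrite /opmul (partition_big (fun u : conf => u x) xpredT) //=.
have only k (u : conf) : u x = k -> u != upd s x k -> at_site x a s u = 0.
  move=> ux /eqP us; rewrite /at_site; case: forallP => // su; case: us.
  apply/ffunP => y; rewrite ffunE; case: eqP => [->//|/eqP yx].
  by have := su y; rewrite yx /= => /eqP.
transitivity (\sum_k at_site x a s (upd s x k) * at_site x b (upd s x k) t).
  apply: eq_bigr => k _; rewrite (bigD1 (upd s x k)) ?ffunE ?eqxx //=.
  rewrite big1 ?addr0 // => u /andP[/eqP ux us].
  by rewrite (only k) // mul0r.
rewrite /at_site /smul.
have e1 k : [forall y, (y != x) ==> (s y == upd s x k y)].
  by apply/forallP => y; apply/implyP => /negPf yx; rewrite ffunE yx.
have e2 k : [forall y, (y != x) ==> (upd s x k y == t y)] =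
    [forall y, (y != x) ==> (s y == t y)].
  by apply: eq_forallb => y; rewrite ffunE; case: eqP.
under eq_bigr => k _ do rewrite e1 e2 ffunE eqxx.
by case: ifP => // _; rewrite big1 // => k _; rewrite mulr0.
Qed.

(** A single intermediate configuration survives: [s] with its value at [x] taken from [t]. The
    resulting formula is symmetric in the two sites, whence commutation. *)
Lemma at_siteM_neq x y (a b : smat) (s t : conf) : x != y ->
  opmul (at_site x a) (at_site y b) s t =
  if [forall z, (z != x) && (z != y) ==> (s z == t z)]
  then a (s x) (t x) * b (s y) (t y) else 0.
Proof.
move=> xy; rewrite /opmul (bigD1 (upd s x (t x))) //= big1 ?addr0; last first.
  move=> u /eqP us; rewrite /at_site.
  case: forallP => [su|]; last by rewrite mul0r.
  case: forallP => [ut|]; last by rewrite mulr0.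
  case: us; apply/ffunP => z; rewrite ffunE; case: eqP => [->|/eqP zx].
    by have := ut x; rewrite xy /= => /eqP.
  by have := su z; rewrite zx /= => /eqP.
rewrite /at_site ffunE eqxx ffunE [y == x]eq_sym (negPf xy).
have -> : [forall z, (z != x) ==> (s z == upd s x (t x) z)].
  by apply/forallP => z; apply/implyP => /negPf zx; rewrite ffunE zx.
have -> : [forall z, (z != y) ==> (upd s x (t x) z == t z)] =
    [forall z, (z != x) && (z != y) ==> (s z == t z)].
  apply: eq_forallb => z; rewrite ffunE; have [->|//] := eqVneq z x.
  by rewrite eqxx implybT.
by case: ifP => // _; rewrite mulr0.
Qed.

Definition site_mx (x : site) (A : spinM) : 'M[C]_n :=
  opmx (at_site x (fun i j => A i j)).

Lemma opmx_at_site x (a : smat) : opmx (at_site x a) = site_mx x (spin_mx a).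
Proof. by apply/matrixP => i j; rewrite !mxE /at_site; case: ifP; rewrite ?mxE. Qed.

Lemma site_mxM x A B : site_mx x (A * B) = site_mx x A *m site_mx x B.
Proof.
rewrite /site_mx -opmxM; apply/matrixP => i j; rewrite !mxE at_siteM /at_site.
by case: ifP => // _; rewrite mxE.
Qed.

Lemma site_mxD x A B : site_mx x (A + B) = site_mx x A + site_mx x B.
Proof. by apply/matrixP => i j; rewrite !mxE /at_site; case: ifP => _; rewrite ?mxE ?addr0. Qed.

Lemma site_mxZ x c A : site_mx x (c *: A) = c *: site_mx x A.
Proof. by apply/matrixP => i j; rewrite !mxE /at_site; case: ifP => _; rewrite ?mxE ?mulr0. Qed.

Lemma site_mxB x A B : site_mx x (A - B) = site_mx x A - site_mx x B.
Proof. by rewrite -scaleN1r site_mxD site_mxZ scaleN1r. Qed.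

Lemma site_mx_scalar x c : site_mx x c%:M = c%:M.
Proof.
apply/matrixP => i j; rewrite !mxE /at_site mxE -(inj_eq enum_val_inj).
case: forallP => [h|h].
  congr (_ *+ nat_of_bool _); apply/eqP/eqP => [e|->] //; apply/ffunP => y.
  by have [->//|yx] := eqVneq y x; have := h y; rewrite yx => /eqP.
by case: eqP => // e; case: h => y; rewrite e eqxx implybT.
Qed.

Lemma site_mx_herm x (a : smat) : (forall i j, (a i j)^*%R = a j i) ->
  (site_mx x (spin_mx a))^t* = site_mx x (spin_mx a).
Proof.
move=> ha; apply/matrixP => i j; rewrite !mxE /at_site !mxE.
under eq_forallb => y do rewrite [enum_val j y == _]eq_sym.
by case: ifP => _; rewrite ?conjC0 ?ha.
Qed.

Lemma site_mxC x y A B : x != y -> site_mx x A *m site_mx y B = site_mx y B *m site_mx x A.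
Proof.
move=> xy; rewrite /site_mx -!opmxM; apply/matrixP => i j; rewrite !mxE.
rewrite !at_siteM_neq // 1?eq_sym // mulrC.
by under eq_forallb => z do rewrite andbC.
Qed.

Lemma comm_site_neq x y A B : x != y -> comm_mxd (site_mx x A) (site_mx y B) = 0.
Proof. by move=> xy; rewrite /comm_mxd site_mxC // subrr. Qed.

Lemma comm_site x A B : comm_mxd (site_mx x A) (site_mx x B) = site_mx x (A * B - B * A).
Proof. by rewrite site_mxB !site_mxM. Qed.

Lemma modS_neq k : (k < L.*2.+2)%N -> (k.+1 %% L.*2.+2)%N != k.
Proof.
move=> hk; have [lt_k|le_k] := ltnP k.+1 L.*2.+2.
  by rewrite modn_small // neq_ltn ltnSn orbT.
have -> : k.+1 = L.*2.+2 by apply/eqP; rewrite eqn_leq hk.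
by rewrite modnn; apply: contraTneq le_k => <-.
Qed.

(** Each periodic direction has at least two sites, so a cyclic step moves; spins joined by a bond
    therefore commute. *)
Lemma adj_neq (x y : site) : adj x y -> x != y.
Proof.
move=> /existsP[j /andP[h _]]; apply: contraTneq h => ->.
by rewrite orbb modS_neq.
Qed.

Definition sigma (x : site) : C := exprz (-1) (\sum_(j < d) Defs.coord x j).

Lemma sigma_real x : (sigma x)^*%R = sigma x.
Proof. by rewrite /sigma expN1r rmorphXn /= rmorphN1. Qed.

Lemma sigma_norm x : `|sigma x| = 1.
Proof. by rewrite /sigma expN1r normrX normrN1 expr1n. Qed.

Local Notation ma x := (site_mx x (spin_mx (@Sx R twoS))).
Local Notation mb x := (site_mx x (spin_mx (@Sy R twoS))).
Local Notation mc x := (site_mx x (spin_mx (@Sz R twoS))).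

Lemma Ham_mx (B : R) : opmx (@Ham R d twoS L B) =
  2^-1 *: (\sum_x \sum_(y | adj x y) (ma x *m ma y + mb x *m mb y + mc x *m mc y)) -
  B%:C *: \sum_x sigma x *: mc x.
Proof.
apply/matrixP => i j; rewrite 3!mxE [X in _ = _ + X]mxE [X in _ = _ - X]mxE.
rewrite /Ham /H0 /stag; congr (_ * _ - _ * _).
  rewrite summxE; apply: eq_bigr => x _; rewrite summxE; apply: eq_bigr => y _.
  rewrite !big_ord_recl big_ord0 addr0 addrA -!opmx_at_site -!opmxM.
  by rewrite !mxE.
rewrite summxE; apply: eq_bigr => x _.
by rewrite mxE -opmx_at_site mxE.
Qed.

Let Hherm B : (opmx (@Ham R d twoS L B))^t* = opmx (@Ham R d twoS L B).
Proof.
have hx x := @site_mx_herm x _ (@Sx_herm R twoS).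
have hy x := @site_mx_herm x _ (@Sy_herm R twoS).
have hz x := @site_mx_herm x _ (@Sz_herm R twoS).
apply: (heisenberg_herm hx hy hz _ (Ham_mx B) sigma_real (conjc_real B)).
by move=> x y /adj_neq xy; split; apply: site_mxC.
Qed.

Variables (beta B : R).
Hypotheses (beta_gt0 : 0 < beta) (B_ge0 : 0 <= B).
Local Notation H := (@Ham R d twoS L B).
Let W := opmx (expm (opscale (- beta)%:C H)).

Let WH : thermal beta%:C (opmx H) W.
Proof.
have [U [e [hU hH]]] := herm_spectral (Hherm B).
apply: (thermal_exp (ltW beta_gt0) hU hH); apply: opmx_expm => //.
by rewrite opmxZ; exact: diag_conjZ.
Qed.

Let n_gt0 : (0 < n)%N.
Proof. by apply/card_gt0P; exists [ffun=> ord0]. Qed.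

Lemma gibbs_state (A : op) : gibbs beta B A = state W (opmx A).
Proof. by rewrite /gibbs /state !trace_opmx opmxM mxtrace_mulC. Qed.

Local Notation kappa := (spinS R twoS * (spinS R twoS + 1)).

Let beta0 : 0 <= beta%:C. Proof. by rewrite ler0c ltW. Qed.
Let B0 : 0 <= B%:C. Proof. by rewrite ler0c. Qed.
Let ha x := @site_mx_herm x _ (@Sx_herm R twoS).
Let hb x := @site_mx_herm x _ (@Sy_herm R twoS).
Let hc x := @site_mx_herm x _ (@Sz_herm R twoS).

Let cas x : ma x *m ma x + mb x *m mb x + mc x *m mc x = kappa%:C%:M.
Proof. by rewrite -!site_mxM -!site_mxD spin_casimir site_mx_scalar. Qed.

Lemma gibbs_corr_bound (x y : site) :
  `|gibbs beta B (opmul (at_site x (@Sy R twoS)) (at_site y (@Sy R twoS)))| <= kappa%:C.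
Proof.
rewrite gibbs_state opmxM !opmx_at_site.
exact: (transverse_corr_bound ha hb hc cas n_gt0 WH).
Qed.

Lemma gibbs_bogoliubov (f : site -> R) (J : finType) (e : J -> site) :
  2 * `|\sum_j (f (e j))%:C * (sigma (e j) * gibbs beta B (at_site (e j) (@Sz R twoS)))| <=
  2^-1 * (kappa%:C * \sum_x \sum_(y | adj x y) ((f x)%:C - (f y)%:C) ^+ 2) +
  B%:C * ((kappa%:C + 1) * \sum_x (f x)%:C ^+ 2) +
  2 * beta%:C * \sum_j \sum_l sigma (e j) * sigma (e l) *
     gibbs beta B (opmul (at_site (e j) (@Sy R twoS)) (at_site (e l) (@Sy R twoS))).
Proof.
have caa z x : comm_mxd (ma z) (ma x) = 0.
  have [->|zx] := eqVneq z x; last exact: comm_site_neq.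
  by rewrite /comm_mxd subrr.
have cab z x : comm_mxd (ma z) (mb x) = if z == x then 'i%R *: mc x else 0.
  have [->|zx] := eqVneq z x; last exact: comm_site_neq.
  by rewrite comm_site spin_comm_xy site_mxZ.
have cac z x : comm_mxd (ma z) (mc x) = if z == x then - 'i%R *: mb x else 0.
  have [->|zx] := eqVneq z x; last exact: comm_site_neq.
  by rewrite comm_site spin_comm_xz site_mxZ.
have f_real x : ((f x)%:C)^*%R = (f x)%:C by exact: conjc_real.
have := heisenberg_bogoliubov ha hb hc caa cab cac cas (Ham_mx B) sigma_real sigma_norm
  n_gt0 B0 beta0 WH e f_real.
congr (2 * `|_| <= _ + _ * _); apply: eq_bigr => j _.
  by rewrite gibbs_state opmx_at_site.
by apply: eq_bigr => l _; rewrite gibbs_state opmxM !opmx_at_site.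
Qed.

End SiteOperators.

(** * Symmetry of the finite-volume Gibbs state *)

Section GibbsLinear.
Variables (R : realType) (d twoS L : nat) (beta B : R).
Local Notation C := R[i].
Local Notation op := (op R d twoS L).
Local Notation g := (@gibbs R d twoS L beta B).

Lemma eq_gibbs (A A' : op) : (forall s t, A s t = A' s t) -> g A = g A'.
Proof. by move=> AA'; congr (g _); apply/funext => s; apply/funext => t. Qed.

Lemma gibbs_lincomb (I : finType) (c : I -> C) (A : I -> op) :
  g (fun s t => \sum_i c i * A i s t) = \sum_i c i * g (A i).
Proof.
rewrite /gibbs /trace /opmul; set E := expm _; set Z := (\sum_s E s s).
under [RHS]eq_bigr => i _ do rewrite mulrA mulr_sumr.
rewrite -mulr_suml; congr (_ / _); rewrite [RHS]exchange_big; apply: eq_bigr => s _ /=.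
under [RHS]eq_bigr => i _ do rewrite mulr_sumr.
rewrite [RHS]exchange_big; apply: eq_bigr => t _ /=.
by rewrite mulr_suml; apply: eq_bigr => i _; rewrite mulrA.
Qed.

Lemma gibbsN (A : op) : g (fun s t => - A s t) = - g A.
Proof.
have := gibbs_lincomb (fun _ : 'I_1 => -1) (fun _ => A); rewrite big_ord1 mulN1r => <-.
by apply: eq_gibbs => s t; rewrite big_ord1 mulN1r.
Qed.

End GibbsLinear.

(* The Hamiltonian is invariant under a one-step translation combined with the
   spin flip m |-> -m; both reverse the sign of the staggered magnetization. *)
Section FlippedTranslation.
Variables (R : realType) (d twoS L : nat) (i : 'I_d).
Local Notation C := R[i].
Local Notation site := (site d L).
Local Notation conf := (conf d twoS L).
Local Notation op := (op R d twoS L).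
Local Notation smat := (smat R twoS).

Definition step (x : site) : site := [ffun k => if k == i then ordS (x k) else x k].
Definition step_back (x : site) : site := [ffun k => if k == i then ord_pred (x k) else x k].

Lemma stepK : cancel step step_back.
Proof. by move=> x; apply/ffunP => k; rewrite !ffunE; case: eqP => // _; rewrite ordSK. Qed.

Lemma step_backK : cancel step_back step.
Proof. by move=> x; apply/ffunP => k; rewrite !ffunE; case: eqP => // _; rewrite ord_predK. Qed.

Lemma shift_bij : bijective step.
Proof. exact: Bijective stepK step_backK. Qed.

Definition flip (s : conf) : conf := [ffun x => rev_ord (s (step x))].

Lemma flip_bij : bijective flip.
Proof.
exists (fun s : conf => [ffun x => rev_ord (s (step_back x))] : conf) => s;
  by apply/ffunP => x; rewrite !ffunE ?stepK ?step_backK rev_ordK.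
Qed.

Lemma adj_ordS (x y : site) : adj x y =
  [exists j, ((ordS (x j) == y j) || (ordS (y j) == x j)) &&
     [forall k, (k != j) ==> (x k == y k)]].
Proof. by []. Qed.

Lemma adj_shift x y : adj (step x) (step y) = adj x y.
Proof.
have ordS_inj : injective (@ordS L.*2.+2) := can_inj (@ordSK _).
rewrite !adj_ordS; apply: eq_existsb => j; congr (_ && _).
  by rewrite !ffunE; case: ifP; rewrite ?(inj_eq ordS_inj).
by apply: eq_forallb => k; rewrite !ffunE; case: ifP; rewrite ?(inj_eq ordS_inj).
Qed.

(** Factoring out the offset of the coordinates leaves natural exponents, whose parity can be
    followed under a cyclic step. *)
Lemma sigmaE (x : site) : sigma R x =
  (\prod_j (-1) ^+ (x j)) * (exprz (-1) (- L%:Z)) ^+ d.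
Proof.
rewrite /sigma (big_morph (exprz (-1)) (id1 := 1) (op1 := *%R)); first last.
- by rewrite expr0z.
- by move=> u v; rewrite expfzDr // oppr_eq0 oner_eq0.
rewrite -[X in _ ^+ X](card_ord d) -prodr_const -big_split; apply: eq_bigr => j _ /=.
by rewrite /Defs.coord expfzDr // oppr_eq0 oner_eq0.
Qed.

Lemma sigma_shift x : sigma R (step x) = - sigma R x.
Proof.
rewrite !sigmaE -mulNr; congr (_ * _); rewrite [LHS](bigD1 i) // [in RHS](bigD1 i) //=.
rewrite -mulNr; congr (_ * _); last first.
  by apply: eq_bigr => j /negPf ji; rewrite ffunE ji.
(* The side 2L + 2 is even, so reduction modulo the side keeps the parity. *)
by rewrite ffunE eqxx -signr_odd /= odd_mod ?oddS ?odd_double // signrN signr_odd.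
Qed.

Lemma at_site_flip (x : site) (a : smat) s t :
  at_site x a (flip s) (flip t) =
  at_site (step x) (fun m' m => a (rev_ord m') (rev_ord m)) s t.
Proof.
rewrite /at_site !ffunE; congr (if _ then _ else _).
apply/forallP/forallP => h y.
  have := h (step_back y); rewrite !ffunE step_backK (inj_eq rev_ord_inj).
  by rewrite -(inj_eq (can_inj stepK)) step_backK.
have := h (step y); rewrite !ffunE (inj_eq rev_ord_inj).
by rewrite (inj_eq (can_inj stepK)).
Qed.

Lemma opmul_flip (A A' : op) s t :
  opmul A A' (flip s) (flip t) =
  opmul (fun s t => A (flip s) (flip t)) (fun s t => A' (flip s) (flip t)) s t.
Proof. by rewrite /opmul (reindex _ (onW_bij _ flip_bij)). Qed.

Lemma at_siteN (x : site) (a a' : smat) (s t : conf) :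
  (forall m' m, a' m' m = - a m' m) -> at_site x a' s t = - at_site x a s t.
Proof. by move=> e; rewrite /at_site; case: ifP; rewrite ?oppr0. Qed.

Lemma eq_at_site (x : site) (a a' : smat) (s t : conf) :
  (forall m' m, a' m' m = a m' m) -> at_site x a' s t = at_site x a s t.
Proof. by move=> e; rewrite /at_site e. Qed.

(** In the exchange term the signs of flipped components cancel in pairs; in the field term the sign
    of the flipped [Sz] cancels that of the shifted [sigma]. *)
Lemma Ham_flip (B : R) s t : Ham B (flip s) (flip t) = @Ham R d twoS L B s t.
Proof.
rewrite /Ham; congr (_ - _ * _).
  rewrite /H0; congr (_ * _); rewrite [RHS](reindex _ (onW_bij _ shift_bij)).
  apply: eq_bigr => x _; rewrite [RHS](reindex _ (onW_bij _ shift_bij)) /=.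
  apply: eq_big => [y|y _]; first by rewrite adj_shift.
  apply: eq_bigr => k _; rewrite opmul_flip; apply: eq_bigr => u _.
  rewrite !at_site_flip /Scomp; case: ifP => _.
    by congr (_ * _); apply: eq_at_site => m' m; rewrite Sx_rev.
  case: ifP => _; last first.
    by rewrite -[RHS]mulrNN; congr (_ * _); apply: at_siteN => m' m; rewrite Sz_rev.
  by rewrite -[RHS]mulrNN; congr (_ * _); apply: at_siteN => m' m; rewrite Sy_rev.
rewrite /stag [RHS](reindex _ (onW_bij _ shift_bij)); apply: eq_bigr => x _ /=.
rewrite -!/(sigma R _) sigma_shift mulNr -mulrN; congr (_ * _).
by rewrite at_site_flip; apply: at_siteN => m' m; rewrite Sz_rev.
Qed.

Lemma expm_flip (A : op) : (forall s t, A (flip s) (flip t) = A s t) ->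
  forall s t, expm A (flip s) (flip t) = expm A s t.
Proof.
move=> hA s t; rewrite /expm; congr climn; apply/funext => N.
apply: eq_bigr => k _; congr (_ / _).
elim: (k : nat) s t => [|m IH] s t.
  by rewrite /oppow /= /opid (inj_eq (bij_inj flip_bij)).
by rewrite /oppow /= opmul_flip; apply: eq_bigr => u _; rewrite hA -!/(oppow A m) IH.
Qed.

Lemma gibbs_flip (beta B : R) (A : op) :
  gibbs beta B (fun s t => A (flip s) (flip t)) = gibbs beta B A.
Proof.
rewrite /gibbs; congr (_ / _).
rewrite /trace [RHS](reindex _ (onW_bij _ flip_bij)); apply: eq_bigr => s _ /=.
rewrite opmul_flip; apply: eq_bigr => u _; rewrite expm_flip // => v w.
by rewrite /opscale Ham_flip.
Qed.

Lemma staggered_shift (beta B : R) (x : site) :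
  sigma R (step x) * gibbs beta B (at_site (step x) (@Sz R twoS)) =
  sigma R x * gibbs beta B (at_site x (@Sz R twoS)).
Proof.
rewrite sigma_shift -[in RHS]gibbs_flip mulNr -mulrN -gibbsN; congr (_ * _).
apply: eq_gibbs => s t; rewrite at_site_flip; apply/esym/at_siteN => m' m.
by rewrite Sz_rev.
Qed.

End FlippedTranslation.

(** Unit steps lead from any site back to the corner, each preserving the staggered value; the
    induction is on the sum of the ordinals. *)
Lemma staggered_const (R : realType) (d twoS L : nat) (beta B : R) (x y : site d L) :
  sigma R x * gibbs beta B (at_site x (@Sz R twoS)) =
  sigma R y * gibbs beta B (at_site y (@Sz R twoS)).
Proof.
suff h (z : site d L) : sigma R z * gibbs beta B (at_site z (@Sz R twoS)) =
    sigma R ([ffun=> ord0] : site d L) * gibbs beta B (at_site ([ffun=> ord0] : site d L) (@Sz R twoS)).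
  by rewrite !h.
move Ek : (\sum_j (z j : nat))%N => k; elim: k z Ek => [|k IH] z.
  move=> /eqP; rewrite sum_nat_eq0 => /forallP z0.
  have -> // : z = [ffun=> ord0].
  by apply/ffunP => j; rewrite ffunE; apply/val_inj/eqP; exact: z0.
move=> Ek; have [j zj] : exists j, (0 < z j)%N.
  apply/existsP; rewrite -[X in is_true X]negbK negb_exists; apply/negP => /forallP z0.
  suff : (\sum_j (z j : nat) = 0)%N by rewrite Ek.
  by apply: big1 => j _; have := z0 j; rewrite -eqn0Ngt => /eqP.
rewrite -[z](step_backK j) staggered_shift; apply: IH; apply: succn_inj; rewrite -Ek.
rewrite (bigD1 j) //= [RHS](bigD1 j) //= ffunE eqxx -addSn; congr (_ + _)%N.
  (* Since [z j] is positive, the backward step does not wrap around. *)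
  rewrite /=; have -> : (z j + L.*2.+2).-1 = ((z j).-1 + L.*2.+2)%N by rewrite -!subn1 addnBAC.
  rewrite modnDr modn_small ?prednK //.
  exact: ltnW.
by apply: eq_bigr => l /negPf lj; rewrite ffunE lj.
Qed.

(** * Embeddings and the tent function *)

Section Embedding.
Variables (R : realType) (d twoS L L' : nat).
Hypothesis LL' : (L <= L')%N.
Local Notation C := R[i].
Local Notation emb := (@emb_site d L L').
Local Notation smat := (smat R twoS).

Lemma emb_siteE (x : site d L) j : (emb x j : nat) = (x j + (L' - L))%N.
Proof. by rewrite ffunE inordK //; have := ltn_ord (x j); lia. Qed.

Lemma emb_site_inj : injective emb.
Proof.
move=> x y e; apply/ffunP => j; apply/val_inj.
have := congr1 (fun z : site d L' => z j : nat) e; rewrite !emb_siteE.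
exact: addIn.
Qed.

Lemma coord_emb (x : site d L) j : Defs.coord (emb x) j = Defs.coord x j.
Proof. by rewrite /Defs.coord emb_siteE PoszD -subzn //; ring. Qed.

Lemma sigma_emb (x : site d L) : sigma R (emb x) = sigma R x.
Proof. by rewrite /sigma; congr exprz; apply: eq_bigr => j _; rewrite coord_emb. Qed.

Lemma embed_at_site (x : site d L) (a : smat) s t :
  @embed _ _ _ _ L' (at_site x a) s t = at_site (emb x) a s t.
Proof.
rewrite /embed LL' /at_site /Defs.restrict !ffunE.
case: (@forallP _ (fun y => (y != emb x) ==> (s y == t y))) => h.
  have -> : [forall y, (y \notin codom emb) ==> (s y == t y)].
    apply/forallP => y; apply/implyP => hy; have := h y.
    by case: eqP hy => [->|//]; rewrite codom_f.
  case: forallP => // h'; case: h' => y; apply/implyP => yx; rewrite !ffunE.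
  by have := h (emb y); rewrite (inj_eq emb_site_inj) yx.
case: forallP => // h1; case: forallP => // h2; case: h => y.
have [/codomP[z ->]|hy] := boolP (y \in codom emb); last by apply/implyP => _; have := h1 y; rewrite hy.
by have := h2 z; rewrite !ffunE (inj_eq emb_site_inj).
Qed.

(** Inverse of the restriction once the exterior configuration is prescribed by [s]. *)
Definition glue (s : conf d twoS L') (u : conf d twoS L) : conf d twoS L' :=
  [ffun y => if [pick x | emb x == y] is Some x then u x else s y].

Lemma restrict_glue s u : Defs.restrict L (glue s u) = u.
Proof.
apply/ffunP => x; rewrite !ffunE; case: pickP => [z /eqP/emb_site_inj -> //|/(_ x)].
by rewrite eqxx.
Qed.

Lemma glue_out s u y : y \notin codom emb -> glue s u y = s y.
Proof.
move=> hy; rewrite ffunE; case: pickP => // x /eqP e.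
by rewrite -e codom_f in hy.
Qed.

(** A contributing intermediate configuration agrees with [s] outside the small box, so its
    restriction determines it and the large sum collapses to the small one. *)
Lemma embed_opmul (A A' : op R d twoS L) s t :
  @embed _ _ _ _ L' (opmul A A') s t = opmul (@embed _ _ _ _ L' A) (@embed _ _ _ _ L' A') s t.
Proof.
rewrite /opmul (partition_big (@Defs.restrict d twoS L L') xpredT) //=.
have only u (w : conf d twoS L') : Defs.restrict L w = u -> w != glue s u ->
    @embed _ _ _ _ L' A s w = 0.
  move=> wu /eqP ws; rewrite /embed LL'; case: forallP => // sw; case: ws.
  apply/ffunP => y; have [/codomP[z ->]|hy] := boolP (y \in codom emb).
    have := congr1 (fun v : conf d twoS L => v z) (restrict_glue s u).
    by rewrite -{2}wu !ffunE.
  by rewrite glue_out //; have := sw y; rewrite hy /= => /eqP.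
transitivity (\sum_u @embed _ _ _ _ L' A s (glue s u) * @embed _ _ _ _ L' A' (glue s u) t); last first.
  apply: eq_bigr => u _; rewrite (bigD1 (glue s u)) ?restrict_glue ?eqxx //=.
  rewrite big1 ?addr0 // => w /andP[/eqP wu ws].
  by rewrite (only u) // mul0r.
rewrite /embed LL'.
have e1 u : [forall y, (y \notin codom emb) ==> (s y == glue s u y)].
  by apply/forallP => y; apply/implyP => hy; rewrite glue_out.
have e2 u : [forall y, (y \notin codom emb) ==> (glue s u y == t y)] =
    [forall y, (y \notin codom emb) ==> (s y == t y)].
  by apply: eq_forallb => y; case: (boolP (y \in _)) => //= hy; rewrite glue_out.
under [RHS]eq_bigr => u _ do rewrite e1 e2 restrict_glue.
by case: ifP => // _; rewrite big1 // => u _; rewrite mulr0.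
Qed.

(** The right side does not involve [L]. This decouples the box in which the magnetization is given
    from the box carrying the trial operator. *)
Lemma gibbs_embed_stag (beta B : R) (x : site d L') :
  (#|site d L|%:R)^-1 * gibbs beta B (@embed _ _ _ _ L' (@stag R d twoS L)) =
  sigma R x * gibbs beta B (at_site x (@Sz R twoS)).
Proof.
have -> : gibbs beta B (@embed _ _ _ _ L' (@stag R d twoS L)) =
    \sum_(y : site d L) sigma R (emb y) * gibbs beta B (at_site (emb y) (@Sz R twoS)).
  rewrite -gibbs_lincomb; apply: eq_gibbs => s t.
  under eq_bigr => y _ do rewrite -embed_at_site sigma_emb.
  rewrite {1}/embed LL'; case: ifP => h; rewrite /stag.
    by apply: eq_bigr => y _; rewrite /embed LL' h.
  by rewrite big1 // => y _; rewrite /embed LL' h mulr0.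
under eq_bigr => y _ do rewrite (staggered_const _ _ _ _ x).
rewrite sumr_const -[(sigma R x * _) *+ _]mulr_natl mulKf // pnatr_eq0 -lt0n.
by apply/card_gt0P; exists [ffun=> ord0].
Qed.

End Embedding.

Section Points.
Variables (R : realType) (d twoS : nat).

Lemma rad_coord K (x : site d K) : (Defs.rad (Defs.coord x) <= K.+1)%N.
Proof.
by apply/bigmax_leqP => j _; rewrite /Defs.coord; have := ltn_ord (x j); lia.
Qed.

(** [S2S2] lives in the box given by the radii of its two points rather than in box [K]; both routes
    into the large box must reach the same site. *)
Lemma emb_to_site K M L' (x : site d K) :
  (Defs.rad (Defs.coord x) <= M)%N -> (M <= L')%N -> (K <= L')%N ->
  emb_site L' (to_site M (Defs.coord x)) = emb_site L' x.
Proof.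
move=> xM ML KL; apply/ffunP => j; apply/val_inj => /=; rewrite !emb_siteE //.
have : (absz (Defs.coord x j) <= M)%N.
  by apply: leq_trans xM; exact: (@leq_bigmax _ (fun j => absz (Defs.coord x j))).
rewrite /to_site /Defs.coord ffunE => h; rewrite inordK; last by lia.
by lia.
Qed.

Lemma gibbs_embed_S2S2 (beta B : R) K L' (x y : site d K) : (K.+1 <= L')%N ->
  gibbs beta B (@embed _ _ _ _ L' (@S2S2 R d twoS (Defs.coord x) (Defs.coord y))) =
  gibbs beta B (opmul (at_site (emb_site L' x) (@Sy R twoS))
                      (at_site (emb_site L' y) (@Sy R twoS))).
Proof.
move=> KL; set M := box2 (Defs.coord x) (Defs.coord y).
have ML : (M <= L')%N by rewrite (leq_trans _ KL) // geq_max !rad_coord.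
apply: eq_gibbs => s t; rewrite /S2S2 embed_opmul //; apply: eq_bigr => u _.
by rewrite !embed_at_site // !emb_to_site ?leq_maxl ?leq_maxr ?(ltnW KL).
Qed.

End Points.

(** * Tent function: Lipschitz property, support and energy *)

Section Tent.
Variables (d L n : nat).
Local Notation site := (site d L).

(** Truncated subtraction on [nat] supplies the value 0 beyond radius 2n. *)
Definition tent (x : site) : nat := minn n (n.*2 - Defs.rad (Defs.coord x)).

(** A bond crossing the periodic boundary joins the coordinates L + 1 and -L, whose absolute values
    also differ by 1; so the tent is Lipschitz there too. *)
Lemma rad_adj (x y : site) : adj x y -> (Defs.rad (Defs.coord x) <= (Defs.rad (Defs.coord y)).+1)%N.
Proof.
move=> /existsP[j /andP[hj /forallP h]]; apply/bigmax_leqP => k _.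
apply: (@leq_trans (absz (Defs.coord y k)).+1); last first.
  by rewrite ltnS; exact: (@leq_bigmax _ (fun j => absz (Defs.coord y j))).
have := h k; have [-> _|_ /= /eqP] := eqVneq k j; last by rewrite /Defs.coord => ->.
move: hj; rewrite /Defs.coord.
have := ltn_ord (x j); have := ltn_ord (y j).
move: (x j : nat) (y j : nat) => a b hb ha.
have modS k' : (k' < L.*2.+2)%N -> (k'.+1 %% L.*2.+2 = k'.+1 \/
    k'.+1 %% L.*2.+2 = 0 /\ k' = L.*2.+1)%N.
  move=> hk; have [lt_k|le_k] := ltnP k'.+1 L.*2.+2; first by rewrite modn_small; auto.
  have -> : k' = L.*2.+1 by lia.
  by rewrite modnn; right.
have ma := modS _ ha; have mb := modS _ hb.
by case/orP => /eqP; move: ma mb; rewrite ?PoszD; lia.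
Qed.

Lemma adjC (x y : site) : adj x y = adj y x.
Proof.
rewrite /adj; apply: eq_existsb => j; rewrite orbC; congr (_ && _).
by apply: eq_forallb => k; rewrite [x k == _]eq_sym.
Qed.

Lemma tent_adj (x y : site) : adj x y -> (tent x <= (tent y).+1)%N.
Proof. by rewrite adjC => /rad_adj; rewrite /tent; lia. Qed.

Lemma card_adj (x : site) : (#|[pred y | adj x y]| <= d.*2)%N.
Proof.
pose nb (p : 'I_d * bool) := if p.2 then step p.1 x else step_back p.1 x.
apply: leq_trans (_ : #|codom nb| <= _)%N; last first.
  by apply: leq_trans (leq_image_card _ _) _; rewrite card_prod card_ord card_bool muln2.
apply/subset_leq_card/fintype.subsetP => y; rewrite inE adj_ordS => /existsP[j /andP[hj /forallP h]].
have h' k : k != j -> y k = x k by move=> kj; have := h k; rewrite kj /= => /eqP.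
case/orP: hj => /eqP hj.
  apply/codomP; exists (j, true); apply/ffunP => k; rewrite ffunE.
  by case: eqP => [->|/eqP/h'].
apply/codomP; exists (j, false); apply/ffunP => k; rewrite ffunE.
by case: eqP => [->|/eqP/h' //]; rewrite -hj ordSK.
Qed.

Lemma card_tent_supp : (0 < n)%N -> (#|[pred x : site | 0 < tent x]| <= (5 * n) ^ d)%N.
Proof.
(* On the support the coordinates lie strictly between -2n and 2n; shifted by 2n they stay below 4n
   <= 5n, so [inord] returns the intended value. *)
move=> n0; pose phi (x : site) : {ffun 'I_d -> 'I_(5 * n).-1.+1} :=
  [ffun j => inord (absz (Defs.coord x j + n.*2%:Z))].
have small (x : site) j : (0 < tent x)%N -> (absz (Defs.coord x j) < n.*2)%N.
  move=> tx; apply: leq_ltn_trans (_ : Defs.rad (Defs.coord x) < _)%N.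
    exact: (@leq_bigmax _ (fun j => absz (Defs.coord x j))).
  by move: tx; rewrite /tent; lia.
have phi_inj : {in [pred x : site | 0 < tent x]%N &, injective phi}.
  move=> x y; rewrite !inE => tx ty e; apply/ffunP => j; apply/val_inj => /=.
  have := congr1 (fun v : {ffun 'I_d -> 'I_(5 * n).-1.+1} => v j : nat) e.
  have := small _ j tx; have := small _ j ty.
  rewrite !ffunE /Defs.coord => h1 h2; rewrite !inordK; lia.
rewrite -(card_in_imset phi_inj); apply: leq_trans (max_card _) _.
by rewrite card_ffun !card_ord prednK // muln_gt0.
Qed.

Lemma tent_core (x : site) : (Defs.rad (Defs.coord x) <= n)%N -> tent x = n.
Proof. by rewrite /tent; lia. Qed.

Variable R : realType.
Local Notation tentR x := ((tent x)%:R : R).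

(** A bond contributes at most 1, and only if an endpoint lies in the support. Counting the support
    once from each endpoint, with at most 2d neighbours per site, gives 4d. *)
Lemma tent_energy : (0 < n)%N ->
  \sum_(x : site) \sum_(y | adj x y) (tentR x - tentR y) ^+ 2 <= ((4 * d) * (5 * n) ^ d)%:R.
Proof.
move=> n0.
have pt x y : adj x y -> (tentR x - tentR y) ^+ 2 <= ((0 < tent x) + (0 < tent y))%N%:R.
  move=> xy; have h1 := tent_adj xy; rewrite adjC in xy; have h2 := tent_adj xy.
  have [h|[h|h]] : tent x = tent y \/ tent x = (tent y).+1 \/ tent y = (tent x).+1 by lia.
  - by rewrite h subrr expr0n.
  - by rewrite h -natr1 addrAC subrr add0r expr1n ler1n addn_gt0.
  - by rewrite h -natr1 opprD addrA subrr add0r sqrrN expr1n ler1n addnC addn_gt0.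
apply: le_trans (_ : \sum_(x : site) \sum_(y | adj x y) ((0 < tent x) + (0 < tent y))%N%:R <= _).
  by apply: ler_sum => x _; apply: ler_sum => y; exact: pt.
have deg : (\sum_(x : site) \sum_(y | adj x y) (0 < tent x) <= d.*2 * (5 * n) ^ d)%N.
  apply: leq_trans (_ : \sum_(x : site) d.*2 * (0 < tent x) <= _)%N.
    by apply: leq_sum => x _; rewrite sum_nat_const leq_mul2r card_adj orbT.
  rewrite -big_distrr /= leq_mul2l; apply/orP; right.
  by rewrite -big_mkcond sum1_card card_tent_supp.
under eq_bigr => x _ do rewrite -natr_sum.
rewrite -natr_sum ler_nat; under eq_bigr => x _ do rewrite big_split.
rewrite big_split /= [X in (_ + X)%N](exchange_big_dep xpredT) //=.
under [X in (_ + X)%N]eq_bigr => x _ do under eq_bigl => y do rewrite adjC.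
apply: leq_trans (leq_add deg deg) _; rewrite -mulnDl leq_mul2r.
by apply/orP; right; lia.
Qed.

Lemma tent_mass : (0 < n)%N ->
  \sum_(x : site) tentR x ^+ 2 <= (n ^ 2 * (5 * n) ^ d)%:R.
Proof.
move=> n0; apply: le_trans (_ : \sum_(x : site) (n ^ 2 * (0 < tent x))%N%:R <= _).
  apply: ler_sum => x _; rewrite -natrX ler_nat.
  case: (posnP (tent x)) => [->//|_]; rewrite muln1 leq_exp2r //.
  by rewrite /tent geq_minl.
rewrite -natr_sum ler_nat -big_distrr /= leq_mul2l; apply/orP; right.
by rewrite -big_mkcond sum1_card card_tent_supp.
Qed.

End Tent.

Section RealNorm.
Variable R : realType.
Local Notation C := R[i].

(** The norm of [R[i]] takes its values in [R[i]]; a value in [R] is needed for real limits. *)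
Definition nrm (z : C) : R := complex.Re `|z|.

Lemma nrmE z : `|z| = (nrm z)%:C.
Proof. by rewrite /nrm normc_def. Qed.

Lemma nrm_ge0 z : 0 <= nrm z.
Proof. by rewrite -ler0c -nrmE. Qed.

Lemma nrmM y z : nrm (y * z) = nrm y * nrm z.
Proof. by apply: complexI; rewrite rmorphM /= -!nrmE normrM. Qed.

Lemma nrm_real (x : R) : nrm x%:C = `|x|.
Proof. by rewrite /nrm normc_def /= expr0n addr0 sqrtr_sqr. Qed.

Lemma Re_le_nrm z : complex.Re z <= nrm z.
Proof. by rewrite -lecR -nrmE (le_trans _ (normc_ge_Re z)) // lecR ler_norm. Qed.

Lemma nrm_dist y z : `|nrm y - nrm z| <= nrm (y - z).
Proof.
have h u v : nrm u - nrm v <= nrm (u - v) by rewrite -lecR rmorphB /= -!nrmE lerB_dist.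
rewrite ler_norml h andbT lerNl opprB; apply: le_trans (h z y) _.
by rewrite -lecR -!nrmE distrC.
Qed.

Lemma cvgC_nrm (u : nat -> C) (l : C) : cvgC u l ->
  ((fun k => nrm (u k)) @ \oo --> nrm l)%classic.
Proof.
move=> ul; apply/cvgrPdistC_lt => e e0; have [N hN] := ul e e0.
near=> k; apply: le_lt_trans (nrm_dist _ _) _.
by rewrite -ltcR -nrmE; apply: hN; near: k; exact: nbhs_infty_ge.
Unshelve. all: by end_near. Qed.

End RealNorm.

(** * The finite-volume inequality *)

Section FiniteVolume.
Variables (R : realType) (d twoS : nat).
Local Notation C := R[i].
Local Notation kappa := (spinS R twoS * (spinS R twoS + 1)).

Lemma card_site K : #|site d K| = ((2 * K.+1) ^ d)%N.
Proof. by rewrite card_ffun !card_ord mul2n doubleS. Qed.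

Lemma nrm_corr_le (beta B : R) K L' (x y : site d K) : 0 < beta -> (K.+1 <= L')%N ->
  nrm (gibbs beta B (@embed _ _ _ _ L' (@S2S2 R d twoS (Defs.coord x) (Defs.coord y)))) <= kappa.
Proof.
move=> beta0 KL; rewrite gibbs_embed_S2S2 // -lecR -nrmE.
exact: gibbs_corr_bound.
Qed.

(** Box [K] carries the trial operator, with n = K + 1; box [L] measures the magnetization; [L'] is
    the volume. Sites of box [K] have radius at most n, so the tent equals n on all of it. The boxes
    of [S2S2] can have index K + 1, hence [K.+1 <= L']. *)
Lemma finite_volume_bound (beta B t : R) (L K L' : nat) :
  0 < beta -> 0 <= B -> 0 <= t -> (L <= L')%N -> (K.+1 <= L')%N ->
  2 * (t * K.+1%:R * #|site d K|%:R) *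
    nrm ((#|site d L|%:R)^-1 * gibbs beta B (@embed _ _ _ _ L' (@stag R d twoS L))) <=
  t ^+ 2 * (2^-1 * (kappa * ((4 * d) * (5 * K.+1) ^ d)%:R)) +
  B * (t ^+ 2 * ((kappa + 1) * (K.+1 ^ 2 * (5 * K.+1) ^ d)%:R)) +
  2 * beta * \sum_(x : site d K) \sum_(y : site d K)
    nrm (gibbs beta B (@embed _ _ _ _ L' (@S2S2 R d twoS (Defs.coord x) (Defs.coord y)))).
Proof.
move=> beta0 B0 t0 LL' KL'; set n := K.+1.
pose e (x : site d K) := emb_site L' x.
pose f (x : site d L') : R := t * (tent n x)%:R.
have kappa0 : 0 <= kappa by rewrite mulr_ge0 ?addr_ge0 // divr_ge0.
have := gibbs_bogoliubov twoS beta0 B0 f e.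
set m := _^-1 * gibbs _ _ _.
have -> : \sum_j (f (e j))%:C * (sigma R (e j) * gibbs beta B (at_site (e j) (@Sz R twoS))) =
    (t * n%:R * #|site d K|%:R)%:C * m.
  transitivity (\sum_(j : site d K) (t * n%:R)%:C * m).
    apply: eq_bigr => j _; rewrite -(gibbs_embed_stag twoS LL') /f tent_core //.
    have -> : Defs.rad (Defs.coord (e j)) = Defs.rad (Defs.coord j).
      by apply: eq_bigr => k _; rewrite coord_emb ?(ltnW KL').
    exact: rad_coord.
  by rewrite sumr_const -mulrnAl -rmorphMn /= !mulr_natr.
have -> : 2^-1 * (kappa%:C * \sum_x \sum_(y | adj x y) ((f x)%:C - (f y)%:C) ^+ 2) =
    (2^-1 * (kappa * \sum_x \sum_(y | adj x y) (f x - f y) ^+ 2))%:C.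
  rewrite [RHS]rmorphM /= fmorphV rmorph_nat [in RHS]rmorphM /= rmorph_sum /=.
  congr (_ * (_ * _)); apply: eq_bigr => x _; rewrite rmorph_sum.
  by apply: eq_bigr => y _; rewrite /= rmorphXn rmorphB.
have -> : B%:C * ((kappa%:C + 1) * \sum_x (f x)%:C ^+ 2) =
    (B * ((kappa + 1) * \sum_x f x ^+ 2))%:C.
  rewrite [RHS]rmorphM /= [in RHS]rmorphM /= rmorphD rmorph1 rmorph_sum /=.
  by congr (_ * (_ * _)); apply: eq_bigr => x _; rewrite rmorphXn.
have -> : 2 * beta%:C = (2 * beta)%:C by rewrite rmorphM /= rmorph_nat.
have -> : 2 * `|(t * n%:R * #|site d K|%:R)%:C * m| =
    (2 * (t * n%:R * #|site d K|%:R) * nrm m)%:C.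
  rewrite nrmE nrmM nrm_real ger0_norm ?mulr_ge0 //.
  rewrite -(rmorph_nat (real_complex R) 2) -rmorphM /=. by congr (_%:C); ring.
have ReE (x y : R) (w : C) :
    complex.Re (x%:C + y%:C + (2 * beta)%:C * w) = x + y + 2 * beta * complex.Re w.
  by case: w => a b /=; rewrite mul0r subr0.
(* Only real parts are kept; the real part of the correlation sum is then bounded termwise by
   moduli, the staggering signs having modulus 1. *)
set T := (X in _ <= _ + _ * X); rewrite lecE ReE => /andP[_].
move=> /le_trans; apply.
rewrite lerD //; last first.
  rewrite ler_pM2l ?mulr_gt0 // /T Re_sum; apply: ler_sum => x _.
  rewrite Re_sum; apply: ler_sum => y _; apply: le_trans (Re_le_nrm _) _.
  rewrite gibbs_embed_S2S2 // nrmM.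
  by rewrite -lecR rmorphM /= -!nrmE normrM !sigma_norm !mul1r.
rewrite lerD //.
  rewrite [X in _ <= X]mulrCA ler_pM2l ?invr_gt0 // mulrCA ler_wpM2l //.
  apply: le_trans (_ : t ^+ 2 * \sum_(x : site d L') \sum_(y | adj x y)
      ((tent n x)%:R - (tent n y)%:R) ^+ 2 <= _).
    rewrite mulr_sumr; apply: ler_sum => x _; rewrite mulr_sumr; apply: ler_sum => y _.
    by rewrite /f -mulrBr exprMn.
  by rewrite ler_wpM2l ?sqr_ge0 // tent_energy.
rewrite ler_wpM2l // mulrCA ler_wpM2l ?addr_ge0 //.
apply: le_trans (_ : t ^+ 2 * \sum_(x : site d L') (tent n x)%:R ^+ 2 <= _).
  by rewrite mulr_sumr; apply: ler_sum => x _; rewrite /f exprMn.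
by rewrite ler_wpM2l ?sqr_ge0 // tent_mass.
Qed.

End FiniteVolume.

(** * Infinite-volume and zero-field limits *)

Section Limits.
Variables (R : realType) (d twoS : nat).
Local Notation C := R[i].
Local Notation kappa := (spinS R twoS * (spinS R twoS + 1)).
Local Notation op := (op R d twoS).
Local Notation corr rho x y := (rho (box2 x y) (@S2S2 R d twoS x y)).

Lemma cvgC_scale (c : C) (u : nat -> C) (l : C) : cvgC u l -> cvgC (fun k => c * u k) (c * l).
Proof.
move=> ul; have [->|c0] := eqVneq c 0.
  move=> e e0; exists 0%N => n _; rewrite !mul0r subrr normr0.
  by rewrite -(rmorph0 (real_complex R)) ltcR.
have nc : 0 < nrm c by rewrite lt_def nrm_ge0 andbT; apply: contra_neq c0 => n0;
  apply/eqP; rewrite -normr_eq0 nrmE n0.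
move=> e e0; have [N hN] := ul (e / nrm c) (divr_gt0 e0 nc).
exists N => n /hN; rewrite -mulrBr normrM !nrmE -rmorphM /= !ltcR.
by rewrite ltr_pdivlMr // mulrC.
Qed.

(** With [K] and [L] fixed only finitely many local expectations enter, and each converges along the
    volumes. *)
Lemma inf_vol_bound (beta B t : R) (rho : forall L, op L -> C) (L K : nat) :
  0 < beta -> 0 <= B -> 0 <= t -> inf_vol_limit beta B rho ->
  2 * (t * K.+1%:R * #|site d K|%:R) * nrm ((#|site d L|%:R)^-1 * rho L (@stag R d twoS L)) <=
  t ^+ 2 * (2^-1 * (kappa * ((4 * d) * (5 * K.+1) ^ d)%:R)) +
  B * (t ^+ 2 * ((kappa + 1) * (K.+1 ^ 2 * (5 * K.+1) ^ d)%:R)) +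
  2 * beta * \sum_(x : site d K) \sum_(y : site d K)
    nrm (corr rho (Defs.coord x) (Defs.coord y)).
Proof.
move=> beta0 B0 t0 [Ls [Ls_incr Ls_cvg]].
have Ls_ge k : (k <= Ls k)%N.
  by elim: k => // k IH; apply: leq_ltn_trans IH (Ls_incr k).
apply: (ler_cvg_to (a := \oo%classic)
  (f := fun k => 2 * (t * K.+1%:R * #|site d K|%:R) *
    nrm ((#|site d L|%:R)^-1 * gibbs beta B (@embed _ _ _ _ (Ls k) (@stag R d twoS L))))
  (g := fun k => t ^+ 2 * (2^-1 * (kappa * ((4 * d) * (5 * K.+1) ^ d)%:R)) +
    B * (t ^+ 2 * ((kappa + 1) * (K.+1 ^ 2 * (5 * K.+1) ^ d)%:R)) +
    2 * beta * \sum_(x : site d K) \sum_(y : site d K)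
    nrm (gibbs beta B (@embed _ _ _ _ (Ls k) (@S2S2 R d twoS (Defs.coord x) (Defs.coord y)))))).
- by apply: cvgMl_tmp; apply: cvgC_nrm; apply: cvgC_scale; exact: Ls_cvg.
- apply: cvgD; first exact: cvg_cst.
  apply: cvgMl_tmp; apply: cvg_big => [|x _]; first exact: add_continuous.
  apply: cvg_big => [|y _]; first exact: add_continuous.
  by apply: cvgC_nrm; exact: Ls_cvg.
near=> k; have hk : (maxn L K.+1 <= k)%N by near: k; exact: nbhs_infty_ge.
by apply: finite_volume_bound => //; apply: leq_trans (Ls_ge k);
  apply: leq_trans hk; rewrite ?leq_maxl ?leq_maxr.
Unshelve. all: by end_near. Qed.

Lemma inf_vol_corr_le (beta B : R) (rho : forall L, op L -> C) K (x y : site d K) :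
  0 < beta -> inf_vol_limit beta B rho -> nrm (corr rho (Defs.coord x) (Defs.coord y)) <= kappa.
Proof.
move=> beta0 [Ls [Ls_incr Ls_cvg]].
have Ls_ge k : (k <= Ls k)%N.
  by elim: k => // k IH; apply: leq_ltn_trans IH (Ls_incr k).
apply: (cvgr_to_le (cvgC_nrm (Ls_cvg _ _))).
near=> k; apply: nrm_corr_le => //; apply: leq_trans (Ls_ge k).
by near: k; exact: nbhs_infty_ge.
Unshelve. all: by end_near. Qed.

Variables (beta : R) (rho : R -> forall L, op L -> C) (rho0 : forall L, op L -> C) (Bs : nat -> R).
Hypotheses (beta0 : 0 < beta)
  (rho_lim : forall B : R, 0 < B -> inf_vol_limit beta B (rho B))
  (Bs_gt0 : forall n, 0 < Bs n)
  (Bs_cvg : forall e : R, 0 < e -> exists N : nat, forall n, (N <= n)%N -> Bs n < e)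
  (rho0_lim : forall L (A : op L), cvgC (fun n => rho (Bs n) A) (rho0 A)).

Lemma zero_field_corr_le K (x y : site d K) :
  nrm (corr rho0 (Defs.coord x) (Defs.coord y)) <= kappa.
Proof.
apply: (cvgr_to_le (cvgC_nrm (rho0_lim _))).
by near=> k; apply: inf_vol_corr_le beta0 _; exact: rho_lim.
Unshelve. all: by end_near. Qed.

(** The coefficient of the field grows with [t] and [K], but both are fixed while the field tends to
    0, so that term drops out. *)
Lemma zero_field_bound (m : C) (t : R) (L K : nat) : 0 <= t ->
  cvg0plus (fun B => (#|site d L|%:R)^-1 * rho B (@stag R d twoS L)) m ->
  2 * (t * K.+1%:R * #|site d K|%:R) * nrm m <=
  t ^+ 2 * (2^-1 * (kappa * ((4 * d) * (5 * K.+1) ^ d)%:R)) +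
  2 * beta * \sum_(x : site d K) \sum_(y : site d K)
    nrm (corr rho0 (Defs.coord x) (Defs.coord y)).
Proof.
move=> t0 hm.
set c := (X in X + _ * _); set c' : R := t ^+ 2 * ((kappa + 1) * (K.+1 ^ 2 * (5 * K.+1) ^ d)%:R).
have Bs0 : (Bs n @[n --> \oo] --> (0 : R))%classic.
  apply/cvgrPdistC_lt => e e0; have [N hN] := Bs_cvg e0.
  near=> n; rewrite subr0 gtr0_norm //; apply: hN; near: n; exact: nbhs_infty_ge.
have mB : cvgC (fun n => (#|site d L|%:R)^-1 * rho (Bs n) (@stag R d twoS L)) m.
  move=> e /hm[delta delta0 h]; have [N hN] := Bs_cvg delta0.
  by exists N => n /hN; exact: h.
apply: (ler_cvg_to (a := \oo%classic)
  (f := fun n => 2 * (t * K.+1%:R * #|site d K|%:R) *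
    nrm ((#|site d L|%:R)^-1 * rho (Bs n) (@stag R d twoS L)))
  (g := fun n => c + Bs n * c' + 2 * beta * \sum_(x : site d K) \sum_(y : site d K)
    nrm (corr (rho (Bs n)) (Defs.coord x) (Defs.coord y)))).
- by apply: cvgMl_tmp; exact: cvgC_nrm.
- apply: cvgD.
    suff : ((fun n => c + Bs n * c') @ \oo --> c + 0 * c')%classic by rewrite mul0r addr0.
    by apply: cvgD; [exact: cvg_cst | exact: cvgMr_tmp].
  apply: cvgMl_tmp; apply: cvg_big => [|x _]; first exact: add_continuous.
  apply: cvg_big => [|y _]; first exact: add_continuous.
  exact: cvgC_nrm.
by near=> n; apply: inf_vol_bound => //; [exact: ltW | exact: rho_lim].
Unshelve. all: by end_near. Qed.

End Limits.

(** * Lattice sums *)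

Section Counting.
Variables (R : realType) (p K : nat).
Local Notation d := p.+2.
Local Notation site := (site d K).
Local Notation n := K.+1.

(** Sup-norm balls are boxes and easy to count; the sup distance is at most the Euclidean one, the
    direction needed to transfer a decay bound. *)
Definition sup_dist (x y : site) : nat := (\max_j absz ((x j)%:Z - (y j)%:Z))%N.

Lemma sup_dist_coord (x y : site) j : (absz ((x j)%:Z - (y j)%:Z) <= sup_dist x y)%N.
Proof. exact: (@leq_bigmax _ (fun j => absz ((x j)%:Z - (y j)%:Z))). Qed.

Lemma sup_dist_le (x y : site) : (sup_dist x y <= 2 * n)%N.
Proof.
by apply/bigmax_leqP => j _; have := ltn_ord (x j); have := ltn_ord (y j); lia.
Qed.

Lemma sup_dist_dist (x y : site) :
  (sup_dist x y)%:R <= @Defs.dist R d (Defs.coord x) (Defs.coord y).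
Proof.
rewrite /sup_dist; elim/big_ind: _ => [|k l hk hl|j _]; first exact: sqrtr_ge0.
  by rewrite /maxn; case: ifP.
rewrite /Defs.dist /Defs.coord.
have -> : (absz ((x j)%:Z - (y j)%:Z))%:R =
    Num.sqrt ((((x j)%:Z - K%:Z) - ((y j)%:Z - K%:Z))%:~R ^+ 2) :> R.
  by rewrite sqrtr_sqr natr_absz intr_norm; congr (`|_%:~R|); ring.
rewrite ler_sqrt ?sumr_ge0 // => [|k _]; last exact: sqr_ge0.
by rewrite [leRHS](bigD1 j) //= lerDl sumr_ge0 // => k _; exact: sqr_ge0.
Qed.

Lemma card_sup_ball (x : site) k : (#|[pred y | sup_dist x y <= k]| <= (2 * k).+1 ^ d)%N.
Proof.
pose phi (y : site) : {ffun 'I_d -> 'I_(2 * k).+1} :=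
  [ffun j => inord (absz ((x j)%:Z - (y j)%:Z + k%:Z))].
have phi_inj : {in [pred y | sup_dist x y <= k]%N &, injective phi}.
  move=> y z; rewrite !inE => hy hz e; apply/ffunP => j; apply/val_inj => /=.
  have := congr1 (fun v : {ffun 'I_d -> 'I_(2 * k).+1} => v j : nat) e.
  have := leq_trans (sup_dist_coord x y j) hy; have := leq_trans (sup_dist_coord x z j) hz.
  by rewrite !ffunE => h1 h2; rewrite !inordK; lia.
rewrite -(card_in_imset phi_inj); apply: leq_trans (max_card _) _.
by rewrite card_ffun !card_ord.
Qed.

(* Trading [D^-p] for a sum over radii [k >= D] reduces the sum over [y] to
   cardinals of balls. *)
Lemma inv_pow_le_sum (D M : nat) : (0 < D)%N -> (D <= M)%N ->
  (D%:R ^- p : R) <=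
  2 ^+ p.+1 * \sum_(0 <= k < (2 * M).+1) (D <= k)%N%:R * k%:R ^- p.+1.
Proof.
move=> D0 DM; have DR : 0 < D%:R :> R by rewrite ltr0n.
have F0 k : 0 <= (D <= k)%N%:R * k%:R ^- p.+1 :> R by rewrite mulr_ge0 // invr_ge0 exprn_ge0.
(* Only the block D <= k < 2D is kept: each of its D terms is at least (2D)^-(p+1). *)
rewrite (big_cat_nat (n := D)) //=; last by lia.
rewrite (big_cat_nat (m := D) (n := (2 * D)%N)) //=; [|lia|lia].
apply: le_trans (_ : 2 ^+ p.+1 * \sum_(D <= k < 2 * D) (2 * D)%:R ^- p.+1 <= _); last first.
  rewrite ler_wpM2l ?exprn_ge0 //; apply: ler_wpDl; first by rewrite sumr_ge0.
  apply: ler_wpDr; first by rewrite sumr_ge0.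
  apply: ler_sum_nat => k /andP[Dk kD]; rewrite Dk mul1r.
  rewrite lef_pV2 ?posrE ?exprn_gt0 ?ltr0n; [|lia..].
  by rewrite lerXn2r ?nnegrE // ler_nat ltnW.
rewrite sumr_const_nat (_ : 2 * D - D = D)%N; last by lia.
rewrite (_ : (2 * D)%:R ^- p.+1 *+ D = 2 ^- p.+1 * D%:R ^- p); last first.
  rewrite -[LHS]mulr_natr natrM exprMn invfM -mulrA; congr (_ * _).
  by rewrite exprSr invfM -mulrA mulVf ?mulr1 // gt_eqF.
by rewrite mulrA mulfV ?mul1r // expf_neq0.
Qed.

(** Pairs within distance [r] cost [kappa] times the size of a ball. For the others, summing over
    [y] first turns a radius k into ball size times k^-(p+1), at most 3^d k since 2k + 1 <= 3k. With
    k <= 4n the total is at most 3^d 4n(4n + 1) <= 3^d 20 n^2. *)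
Lemma decay_sum (a : site -> site -> R) (kappa e : R) (r : nat) :
  0 <= kappa -> 0 <= e -> (0 < r)%N -> (forall x y, a x y <= kappa) ->
  (forall x y, (r <= sup_dist x y)%N -> a x y <= e * (sup_dist x y)%:R ^- p) ->
  \sum_x \sum_y a x y <=
  #|site|%:R * (kappa * ((2 * r).+1 ^ d)%:R + e * (2 ^+ p.+1 * 3 ^+ d * 20) * n%:R ^+ 2).
Proof.
move=> kappa0 e0 r0 a_le a_decay.
suff h x : \sum_y a x y <=
    kappa * ((2 * r).+1 ^ d)%:R + e * (2 ^+ p.+1 * 3 ^+ d * 20) * n%:R ^+ 2.
  apply: le_trans (ler_sum _ (fun x _ => h x)) _.
  by rewrite sumr_const -[_ *+ _]mulr_natl.
pose w k : R := k%:R ^- p.+1.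
apply: le_trans (_ : \sum_y (kappa * (sup_dist x y <= r)%N%:R + e * (2 ^+ p.+1 *
    \sum_(0 <= k < (4 * n).+1) (sup_dist x y <= k)%N%:R * w k)) <= _).
  apply: ler_sum => y _.
  have S0 : 0 <= \sum_(0 <= k < (4 * n).+1) (sup_dist x y <= k)%N%:R * w k.
    by apply: sumr_ge0 => k _; rewrite mulr_ge0 // invr_ge0 exprn_ge0.
  have [le_r|gt_r] := leqP (sup_dist x y) r.
    by rewrite mulr1; apply: ler_wpDr; rewrite ?a_le // !mulr_ge0 ?exprn_ge0.
  rewrite mulr0 add0r; apply: le_trans (a_decay _ _ (ltnW gt_r)) _.
  rewrite ler_wpM2l // (_ : 4 * n = 2 * (2 * n))%N; last by rewrite mulnA.
  by apply: inv_pow_le_sum; [exact: leq_ltn_trans gt_r | exact: sup_dist_le].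
have ball k : \sum_y (sup_dist x y <= k)%N%:R <= ((2 * k).+1 ^ d)%:R :> R.
  by rewrite -natr_sum -big_mkcond sum1_card ler_nat card_sup_ball.
rewrite big_split /= -!mulr_sumr; apply: lerD; first by rewrite ler_wpM2l.
have -> : e * (2 ^+ p.+1 * 3 ^+ d * 20) * n%:R ^+ 2 =
    e * (2 ^+ p.+1 * (3 ^+ d * (20 * n%:R ^+ 2))) by rewrite !mulrA.
rewrite ler_wpM2l // ler_wpM2l ?exprn_ge0 // exchange_big /=.
apply: le_trans (_ : \sum_(0 <= k < (4 * n).+1) 3 ^+ d * (4 * n)%:R <= _).
  apply: ler_sum_nat => k /andP[_ hk]; rewrite -mulr_suml.
  (* The convention 0^-1 = 0 makes the term k = 0 vanish. *)
  have [->|k0] := posnP k.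
    by rewrite /w expr0n invr0 mulr0 mulr_ge0 ?exprn_ge0.
  have kR : 0 < k%:R :> R by rewrite ltr0n.
  apply: le_trans (_ : (3 * k%:R) ^+ d * w k <= _).
    rewrite ler_wpM2r ?invr_ge0 ?exprn_ge0 //; apply: le_trans (ball k) _.
    by rewrite -natrM natrX lerXn2r ?nnegrE // ler_nat; lia.
  rewrite exprMn /w -mulrA ler_wpM2l ?exprn_ge0 // exprS mulfK ?expf_neq0 ?gt_eqF //.
  by rewrite ler_nat -ltnS.
rewrite sumr_const_nat subn0 -[leLHS]mulr_natr -mulrA ler_wpM2l ?exprn_ge0 //.
rewrite -natrX -!natrM ler_nat; nia.
Qed.

End Counting.

(** Compares the volume bound for the support of the tent with the number of sites of the inner box,
    so that the latter can be divided out. *)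
Lemma leq_exp_five_six k p : ((5 * k) ^ p <= 3 ^ p * (2 * k) ^ p)%N.
Proof.
rewrite -expnMn; case: p => // p; rewrite leq_exp2r // mulnA.
by rewrite leq_mul2r orbT.
Qed.

(** * Choice of constants and contradiction *)

Theorem theorem2p5 (R : realType) (d twoS : nat) :
  (3 <= d)%N -> (0 < twoS)%N ->
  forall (beta : R), 0 < beta ->
  forall (rho : R -> forall L : nat, op R d twoS L -> R[i])
         (rho0 : forall L : nat, op R d twoS L -> R[i])
         (Bs : nat -> R),
  (* rho_B is an infinite-volume (weak-* ) limit of Gibbs states, for each B > 0 *)
  (forall B : R, 0 < B -> @inf_vol_limit R d twoS beta B (rho B)) ->
  (* rho_0 = weak-* lim of rho_{B_n} along a sequence B_n decreasing to 0 *)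
  (forall n, 0 < Bs n) -> (forall n, Bs n.+1 < Bs n) ->
  (forall e : R, 0 < e -> exists N : nat, forall n, (N <= n)%N -> Bs n < e) ->
  (forall (L : nat) (A : op R d twoS L), cvgC (fun n => rho (Bs n) L A) (rho0 L A)) ->
  (* m_s = lim_{B -> 0+} |Lambda|^-1 rho_B(O^(Lambda)) exists and is nonzero *)
  (exists (L : nat) (m : R[i]), m != 0 /\
     cvg0plus (fun B => (#|site d L|%:R)^-1 * rho B L (@stag R d twoS L)) m) ->
  (* then |x-y|^(d-2) |rho_0(S_x^(2) S_y^(2))| does not tend to 0 *)
  ~ (forall e : R, 0 < e -> exists r : R, forall x y : pt d,
        r <= @dist R d x y ->
        ((@dist R d x y) ^+ (d - 2))%:C * `|rho0 (box2 x y) (@S2S2 R d twoS x y)| < e%:C).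
Proof.
move=> d3 S0 beta beta0 rho rho0 Bs rho_lim Bs_gt0 _ Bs_cvg rho0_lim [L [m [m0 hm]]] decay.
have [p dE] : exists p, d = p.+2 by exists (d - 2)%N; lia.
subst d; rewrite !subSS subn0 in decay.
set kappa : R := spinS R twoS * (spinS R twoS + 1).
have kappa0 : 0 <= kappa by rewrite mulr_ge0 ?addr_ge0 // divr_ge0.
pose mu := nrm m.
have mu0 : 0 < mu.
  rewrite lt_def nrm_ge0 andbT; apply: contra_neq m0 => e; apply/eqP.
  by rewrite -normr_eq0 nrmE -/mu e.
(* Bounds the gradient energy per site of the inner box and per t^2; the added 1 makes [A]
   positive. *)
pose A : R := kappa * (2 * p.+2%:R) * 3 ^+ p.+2 + 1.
have kd0 : 0 <= kappa * (2 * p.+2%:R) by apply: mulr_ge0 => //; rewrite mulr_ge0.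
have A0 : 0 < A by rewrite ltr_wpDl // mulr_ge0 ?exprn_ge0.
pose C1 : R := 2 ^+ p.+1 * 3 ^+ p.+2 * 20.
have C10 : 0 < C1 by rewrite mulr_gt0 // mulr_gt0 // exprn_gt0.
(* The maximum of 2 s mu - s^2 A, attained at s = mu / A. *)
pose q : R := mu ^+ 2 / A.
have q0 : 0 < q by rewrite divr_gt0 ?exprn_gt0.
(* Chosen so that the distant pairs cost 2 beta e C1 n^2 = q n^2 / 4 per site. *)
pose e : R := q / (8 * beta * C1).
have bC0 : 0 < 8 * beta * C1 by rewrite mulr_gt0 // mulr_gt0.
have e0 : 0 < e by rewrite divr_gt0.
have [r hr] := decay e e0.
(* The successor gives the positive natural radius required by [decay_sum]. *)
pose r1 := (Num.bound `|r|).+1.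
have r1_gt : r <= r1%:R.
  apply: le_trans (ler_norm _) _; apply/ltW; apply: lt_le_trans (archi_boundP (normr_ge0 _)) _.
  by rewrite ler_nat.
pose Q : R := kappa * ((2 * r1).+1 ^ p.+2)%:R.
have Q0 : 0 <= Q by rewrite mulr_ge0.
(* Makes n = K + 1 so large that the near pairs cost 2 beta Q < q n / 4. *)
pose K := Num.bound (8 * beta * Q / q).
have hK : 8 * beta * Q < q * K.+1%:R.
  rewrite [ltRHS]mulrC -ltr_pdivrMr //; apply: lt_le_trans (archi_boundP _) _.
    by rewrite divr_ge0 ?(ltW q0) // mulr_ge0 // mulr_ge0 // ltW.
  by rewrite ler_nat.
pose a (x y : site p.+2 K) : R :=
  nrm (rho0 (box2 (Defs.coord x) (Defs.coord y)) (@S2S2 R p.+2 twoS (Defs.coord x) (Defs.coord y))).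
have a_le x y : a x y <= kappa by apply: (zero_field_corr_le beta0 rho_lim Bs_gt0 rho0_lim).
have a_decay x y : (r1 <= sup_dist x y)%N -> a x y <= e * (sup_dist x y)%:R ^- p.
  move=> r1D; have D0 : 0 < (sup_dist x y)%:R :> R by rewrite ltr0n (leq_trans _ r1D).
  have Dd := sup_dist_dist R x y.
  have rd : r <= dist R (Defs.coord x) (Defs.coord y).
    by apply: le_trans r1_gt _; apply: le_trans Dd; rewrite ler_nat.
  have := hr _ _ rd; rewrite nrmE -rmorphM /= ltcR -/(a x y) => /ltW h.
  rewrite ler_pdivlMr ?exprn_gt0 // mulrC; apply: le_trans h.
  by rewrite ler_wpM2r ?nrm_ge0 // lerXn2r ?nnegrE ?(le_trans _ Dd).
have sum_le := decay_sum kappa0 (ltW e0) (isT : (0 < r1)%N) a_le a_decay.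
pose n : R := K.+1%:R; have n1 : 1 <= n by rewrite ler1n.
have n0 : 0 < n by apply: lt_le_trans n1.
pose N : R := #|site p.+2 K|%:R.
have N0 : 0 < N by rewrite ltr0n card_site expn_gt0.
pose s : R := mu / A.
have s0 : 0 < s by rewrite divr_gt0.
(* Instantiated at t = s n, which puts the gain and the gradient energy both at order n^2 N. *)
have := zero_field_bound beta0 rho_lim Bs_gt0 Bs_cvg rho0_lim K
  (mulr_ge0 (ltW s0) (ltW n0)) hm.
rewrite -/n -/N -/kappa -/mu -/(a _ _) => main.
have energy : (s * n) ^+ 2 * (2^-1 * (kappa * ((4 * p.+2) * (5 * K.+1) ^ p.+2)%:R)) <=
    (s * n) ^+ 2 * (A * N).
  rewrite ler_wpM2l ?sqr_ge0 //.
  have vol : ((5 * K.+1) ^ p.+2)%:R <= 3 ^+ p.+2 * N.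
    by rewrite /N card_site -(natrX _ 3) -natrM ler_nat leq_exp_five_six.
  apply: le_trans (_ : kappa * (2 * p.+2%:R) * (3 ^+ p.+2 * N) <= _); last first.
    have -> : A * N = kappa * (2 * p.+2%:R) * (3 ^+ p.+2 * N) + N.
      by rewrite /A mulrDl mul1r [in RHS]mulrA.
    by rewrite lerDl ltW.
  apply: le_trans (_ : kappa * (2 * p.+2%:R) * ((5 * K.+1) ^ p.+2)%:R <= _); last first.
    by rewrite ler_wpM2l.
  rewrite natrM natrM le_eqVlt; apply/orP; left; apply/eqP.
  by move: (((5 * K.+1) ^ p.+2)%:R : R) => X; field.
have sum_le' : 2 * beta * \sum_x \sum_y a x y <= 2 * beta * (N * (Q + e * C1 * n ^+ 2)).
  by rewrite ler_pM2l ?mulr_gt0.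
have key : 2 * (s * n * n * N) * mu <= (s * n) ^+ 2 * (A * N) +
    2 * beta * (N * (Q + e * C1 * n ^+ 2)).
  exact: le_trans main (lerD energy sum_le').
have {}key : 2 * (s * n * n) * mu <= (s * n) ^+ 2 * A + 2 * beta * (Q + e * C1 * n ^+ 2).
  rewrite -(ler_pM2l N0); move: key; congr (_ <= _); ring.
have sA : s * A = mu by rewrite /s mulfVK // gt_eqF.
have smu : s * mu = q by rewrite /s /q expr2 mulrAC.
have be : 8 * beta * C1 * e = q.
  by rewrite /e mulrC mulfVK // gt_eqF.
have k1 : 2 * (s * n * n) * mu = 2 * (q * n ^+ 2) by rewrite -smu; ring.
have k2 : (s * n) ^+ 2 * A = q * n ^+ 2 by rewrite -smu -sA; ring.
have k3 : 2 * beta * (e * C1 * n ^+ 2) = q * n ^+ 2 / 4 by rewrite -be; field.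
rewrite k1 k2 mulrDr k3 in key.
(* With X = q n^2 and Y = q n, what remains is 2X <= X + 2 beta Q + X/4 and 8 beta Q < Y <= X,
   impossible for X > 0. *)
have : q * n <= q * n ^+ 2 by rewrite ler_pM2l // expr2 ler_peMr // ltW.
have : 0 < q * n ^+ 2 by rewrite mulr_gt0 ?exprn_gt0.
move: hK key; rewrite -/n; move: (q * n ^+ 2) (q * n) => X Y.
lra.
Qed.
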